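(* Let $T>0$ and let $\mathcal{B}=C^{0}([0,T);H^{4}(\mathbb{R}))\cap C^{1}([0,T);H^{3}(\mathbb{R}))$. Then both the local form $$u_t-u_{txx}+4uu_x=3u_xu_{xx}+uu_{xxx}$$ and the non-local form $$u_t+uu_x+\tfrac{3}{2}\partial_x\Lambda^{-2}(u^2)=0$$ of the Degasperis–Procesi (DP) equation describe pseudospherical surfaces of Gaussian curvature $-1$ and class $C^1$ modelled by $\mathcal{B}$ (i.e. each is a $\mathcal{B}$-PSS equation of class $C^1$), with the one-forms $\omega_1,\omega_2,\omega_3$ given below. In particular, in this class of solutions, the surfaces described by the local form are equivalent to those described by the non-local form. Furthermore, a function $u\in\mathcal{B}$ is a solution of the local form if and only if it is a solution of the non-local form.
   Context: $H^s(\mathbb{R})$ denotes the $L^2$-based Sobolev space of order $s$; $C^0([0,T);H^4(\mathbb{R}))$ is the space of continuous maps $t\mapsto u(\cdot,t)$ from $[0,T)$ to $H^4(\mathbb{R})$, and $C^1([0,T);H^3(\mathbb{R}))$ the continuously differentiable ones into $H^3(\mathbb{R})$. The operator $\Lambda^{-2}=(1-\partial_x^2)^{-1}$ acts by $\Lambda^{-2}f=G\ast f$ with $G(x)=\tfrac12 e^{-|x|}$, and $\partial_x\Lambda^{-2}f=G'\ast f$ with $G'(x)=-\tfrac12\,\mathrm{sgn}(x)e^{-|x|}$. For a function $u(x,t)$ set $m=u-u_{xx}$ and $F=u_x^2-2uu_x+uu_{xx}$. For a real parameter $\mu$ and a fixed choice of sign (upper signs together or lower signs together), define $\omega_1=m\,dx+F\,dt$,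 $\omega_2=\big(\mu m\pm2\sqrt{1+\mu^2}\big)dx+\mu F\,dt$, $\omega_3=\big(\pm\sqrt{1+\mu^2}\,m+2\mu\big)dx\pm\sqrt{1+\mu^2}\,F\,dt$. Definition ($\mathcal{B}$-PSS equation of class $C^k$): given a function space $\mathcal{B}$, a differential equation $\mathcal{E}(x,t,u,u_{(1)},\dots,u_{(n)})=0$ for $u\in\mathcal{B}$ describes a pseudospherical surface of Gaussian curvature $-1$ and class $C^k$ modelled by $\mathcal{B}$ if it is a necessary and sufficient condition for the existence of functions $f_{ij}$ ($1\le i\le3$, $1\le j\le2$) depending on $x,t,u$ and finitely many derivatives of $u$ such that: $\mathcal{B}\subseteq C^k$; the $f_{ij}$ are $C^k$ in their arguments; the forms $\omega_i=f_{i1}dx+f_{i2}dt$ satisfy $d\omega_1=\omega_3\wedge\omega_2$, $d\omega_2=\omega_1\wedge\omega_3$, $d\omega_3=\omega_1\wedge\omega_2$; and $\omega_1\wedge\omega_2\neq0$. Such forms endow the region with the metric $\omega_1^2+\omega_2^2$ of Gaussian curvature $-1$. *)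

(* Defs.v *)
From HB Require Import structures.
From mathcomp Require Import all_boot all_order all_algebra.
From mathcomp Require Import all_classical all_reals all_analysis.
Set Implicit Arguments. Unset Strict Implicit. Unset Printing Implicit Defensive.
Import Order.TTheory GRing.Theory Num.Theory.
Import numFieldNormedType.Exports.
Local Open Scope classical_set_scope.
Local Open Scope ring_scope.

Definition iterD (R : realType) (j : nat) (phi : R -> R) : R -> R :=
  iter j (fun g : R -> R => derive1 g) phi.

Definition test_fun (R : realType) (phi : R -> R) : Prop :=
  (forall (j : nat) (x : R), derivable (iterD j phi) x 1) /\
  exists M : R, forall x : R, M < `|x| -> phi x = 0.

Definition L2 (R : realType) (f : R -> R) : Prop :=
  measurable_fun setT f /\
  (\int[@lebesgue_measure R]_x ((f x ^+ 2)%:E) < +oo)%E.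

Definition weak_deriv (R : realType) (j : nat) (f g : R -> R) : Prop :=
  forall phi : R -> R, test_fun phi ->
    \int[@lebesgue_measure R]_x (f x * iterD j phi x) =
    (-1) ^+ j * \int[@lebesgue_measure R]_x (g x * phi x).

Definition weak_derivs (R : realType) (k : nat) (f : R -> R) (D : nat -> R -> R)
  : Prop :=
  (forall x, D 0%N x = f x) /\
  (forall j : nat, (j <= k)%N -> L2 (D j) /\ weak_deriv j f (D j)).

Definition Hk (R : realType) (k : nat) (f : R -> R) : Prop :=
  exists D, weak_derivs k f D.

Definition Hk_norm_lt (R : realType) (k : nat) (f : R -> R) (e : R) : Prop :=
  exists D, weak_derivs k f D /\
    (\sum_(j < k.+1) \int[@lebesgue_measure R]_x ((D j x ^+ 2)%:E) < (e ^+ 2)%:E)%E.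

(* u : R -> R -> R is read as u(x,t).  Elements of H^k(R), k >= 1, are *)
(* identified with their continuous representative.                    *)

Definition in_time (R : realType) (T t : R) : Prop := 0 <= t /\ t < T.

Definition inB (R : realType) (T : R) (u : R -> R -> R) : Prop :=
  (* continuous representative of u(.,t) *)
  (forall t, in_time T t -> continuous (fun x => u x t)) /\
  (forall t, in_time T t -> Hk 4 (fun x => u x t)) /\
  (forall t, in_time T t -> forall e : R, 0 < e -> exists d : R, 0 < d /\
     forall s, in_time T s -> `|s - t| < d ->
       Hk_norm_lt 4 (fun x => u x s - u x t) e) /\
  (exists v : R -> R -> R,
     (forall t, in_time T t -> Hk 3 (v t)) /\
     (forall t, in_time T t -> forall e : R, 0 < e -> exists d : R, 0 < d /\
        forall s, in_time T s -> `|s - t| < d ->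
          Hk_norm_lt 3 (fun x => v s x - v t x) e) /\
     (forall t, in_time T t -> forall e : R, 0 < e -> exists d : R, 0 < d /\
        forall s, in_time T s -> s != t -> `|s - t| < d ->
          Hk_norm_lt 3 (fun x => (u x s - u x t) / (s - t) - v t x) e)).

Definition pdx (R : realType) (g : R -> R -> R) : R -> R -> R :=
  fun x t => derive1 (fun y => g y t) x.
Definition pdt (R : realType) (g : R -> R -> R) : R -> R -> R :=
  fun x t => derive1 (fun s => g x s) t.

Definition strip (R : realType) (T : R) : set (R * R) :=
  [set p | 0 < p.2 /\ p.2 < T].

Definition C1_strip (R : realType) (T : R) (g : R -> R -> R) : Prop :=
  (forall x t, 0 < t < T ->
     derivable (fun y => g y t) x 1 /\ derivable (fun s => g x s) t 1) /\
  {within strip T, continuous (fun p : R * R => g p.1 p.2)} /\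
  {within strip T, continuous (fun p : R * R => pdx g p.1 p.2)} /\
  {within strip T, continuous (fun p : R * R => pdt g p.1 p.2)}.

Definition jc (R : realType) (p : 'rV[R]_5) (k : nat) : R := p ord0 (inord k).

Definition jet (R : realType) (u : R -> R -> R) (x t : R) : 'rV[R]_5 :=
  \row_(i < 5) nth 0 [:: x; t; u x t; pdx u x t; pdx (pdx u) x t] i.

Definition C1_jet (R : realType) (g : 'rV[R]_5 -> R) : Prop :=
  continuous g /\
  forall i : 'I_5,
    (forall p, derivable g p (delta_mx ord0 i)) /\
    continuous (fun p => 'D_(delta_mx ord0 i) g p).

(* f i j (0-based: i < 3, j < 2) is the coefficient f_{(i+1)(j+1)}:
   omega_{i+1} = f i 0 dx + f i 1 dt *)
Definition coef (R : realType) (f : nat -> nat -> 'rV[R]_5 -> R)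
  (u : R -> R -> R) (i j : nat) : R -> R -> R :=
  fun x t => f i j (jet u x t).

(* coefficient of dx /\ dt in d omega_{i+1} *)
Definition dform (R : realType) (f : nat -> nat -> 'rV[R]_5 -> R)
  (u : R -> R -> R) (i : nat) (x t : R) : R :=
  pdx (coef f u i 1) x t - pdt (coef f u i 0) x t.

(* coefficient of dx /\ dt in omega_{a+1} /\ omega_{b+1} *)
Definition wedge (R : realType) (f : nat -> nat -> 'rV[R]_5 -> R)
  (u : R -> R -> R) (a b : nat) (x t : R) : R :=
  coef f u a 0 x t * coef f u b 1 x t - coef f u a 1 x t * coef f u b 0 x t.

Definition structure_eqs (R : realType) (T : R)
  (f : nat -> nat -> 'rV[R]_5 -> R) (u : R -> R -> R) : Prop :=
  forall x t, 0 < t < T ->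
    (forall i : nat, (i < 3)%N ->
       derivable (fun y => coef f u i 1 y t) x 1 /\
       derivable (fun s => coef f u i 0 x s) t 1) /\
    dform f u 0 x t = wedge f u 2 1 x t /\
    dform f u 1 x t = wedge f u 0 2 x t /\
    dform f u 2 x t = wedge f u 0 1 x t.

Definition PSS_C1 (R : realType) (T : R) (B : (R -> R -> R) -> Prop)
  (E : (R -> R -> R) -> Prop) (f : nat -> nat -> 'rV[R]_5 -> R) : Prop :=
  (forall u, B u -> C1_strip T u) /\
  (forall i j : nat, (i < 3)%N -> (j < 2)%N -> C1_jet (f i j)) /\
  (exists p, f 0%N 0%N p * f 1%N 1%N p - f 0%N 1%N p * f 1%N 0%N p != 0) /\
  (forall u, B u -> (E u <-> structure_eqs T f u)).

Definition DP_local (R : realType) (T : R) (u : R -> R -> R) : Prop :=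
  forall x t, 0 < t < T ->
    pdt u x t - pdt (pdx (pdx u)) x t + 4 * u x t * pdx u x t =
    3 * pdx u x t * pdx (pdx u) x t + u x t * pdx (pdx (pdx u)) x t.

Definition Gp (R : realType) (z : R) : R :=
  - (1 / 2) * Num.sg z * expR (- `|z|).

(* (d_x Lambda^{-2} g)(x) = (G' * g)(x) *)
Definition dxLambdam2 (R : realType) (g : R -> R) (x : R) : R :=
  \int[@lebesgue_measure R]_y (Gp (x - y) * g y).

Definition DP_nonlocal (R : realType) (T : R) (u : R -> R -> R) : Prop :=
  forall x t, 0 < t < T ->
    pdt u x t + u x t * pdx u x t +
    (3 / 2) * dxLambdam2 (fun y => u y t ^+ 2) x = 0.

(* m = u - u_xx, F = u_x^2 - 2 u u_x + u u_xx, in jet variables *)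
Definition jm (R : realType) (p : 'rV[R]_5) : R := jc p 2 - jc p 4.
Definition jF (R : realType) (p : 'rV[R]_5) : R :=
  jc p 3 ^+ 2 - 2 * jc p 2 * jc p 3 + jc p 2 * jc p 4.

(* the one-forms; b = true: upper signs, b = false: lower signs *)
Definition DP_forms (R : realType) (mu : R) (b : bool)
  (i j : nat) (p : 'rV[R]_5) : R :=
  let s : R := if b then 1 else -1 in
  let r : R := Num.sqrt (1 + mu ^+ 2) in
  match i, j with
  | O, O => jm p
  | O, _ => jF p
  | S O, O => mu * jm p + s * 2 * r
  | S O, _ => mu * jF p
  | _, O => s * r * jm p + 2 * mu
  | _, _ => s * r * jF p
  end.

(* Main.v *)
(* Every [u] in the space is classically regular. Testing the weak derivative
   against smoothed indicators of intervals shows that [f b - f a] is the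
   integral of the weak derivative at Lebesgue points [a < b], so H^(k+1)
   functions are C^k with sup bounds on the derivatives. Applied to differences
   and to difference quotients in time this gives [d_t d_x^j u = d_x^j u_t] for
   [j <= 2] and the C^1 class. Each structure equation is a multiple of
   [F_x - m_t + 2 F = 0], which is the local equation, and the first is that
   equation itself. Finally, if [w] denotes the left-hand side of the non-local
   equation, the kernel identity [(G' * g)'' = G' * g - g'] shows that [w - w'']
   is the defect of the local one; as [w] is bounded, [w'' = w] forces [w = 0]. *)
From Pilot Require Import Defs.
From HB Require Import structures.
From mathcomp Require Import all_boot all_order all_algebra.
From mathcomp Require Import all_classical all_reals all_analysis.
From mathcomp Require Import measurable_realfun.
From mathcomp Require Import ring lra.
Set Implicit Arguments. Unset Strict Implicit. Unset Printing Implicit Defensive.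
Import Order.TTheory GRing.Theory Num.Theory.
Import numFieldNormedType.Exports.
Import Pilot.Defs.
Local Open Scope classical_set_scope.
Local Open Scope ring_scope.

(** * Real derivatives and a smooth step *)

Section RealDerivatives.
Variable R : realType.
Implicit Types f g : R -> R.

(** Membership in the space speaks of L2 classes, while the equations and the forms use pointwise
    derivatives. The orders are just enough for the passage, which costs one derivative: H^4 gives
    [u_xxx] and H^3 gives two x-derivatives of [u_t], the highest ones in the local equation. A weak
    derivative is known only through its pairings with test functions, so smoothed indicators that
    are differentiable to all orders have to be constructed; this is the purpose of [smooth_step].
    The L2 estimates rest on the bound of [|f g|] by [f^2 / K + K g^2], where [K] makes one term
    small before an interval length makes the other small. The two equations are compared on a whole
    line at fixed time: there the local one determines [w] up to the kernel of [1 - d_x^2], spanned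
    by [e^x] and [e^-x], and a bound on [w] removes both. *)

Lemma derive1_ext f f' : (forall x : R, is_derive x 1 f (f' x)) -> derive1 f = f'.
Proof. by move=> d; apply/funext => x; rewrite derive1E; apply: derive_val. Qed.

(** Counting derivatives lets closure under products and inverses go by induction on [n]: the
    derivative is again built from sums and products, to which the lower case applies. Smoothness is
    the conjunction over all [n]. *)
Fixpoint diff_upto (n : nat) f : Prop :=
  if n is m.+1 then (forall x : R, derivable f x 1) /\ diff_upto m (derive1 f)
  else True.

Lemma diff_upto_S n f f' : (forall x : R, is_derive x 1 f (f' x)) ->
  diff_upto n f' -> diff_upto n.+1 f.
Proof. by move=> d df'; split=> //; rewrite (derive1_ext d). Qed.

Lemma diff_upto_is_derive n f : diff_upto n.+1 f ->
  forall x : R, is_derive x 1 f (derive1 f x).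
Proof. by move=> [d _] x; rewrite derive1E; apply/derivableP. Qed.

Lemma diff_upto_pred n f : diff_upto n.+1 f -> diff_upto n f.
Proof. by elim: n f => // n IH f [df dd]; split => //; apply: IH. Qed.

Lemma diff_upto_iterD f : (forall n, diff_upto n f) ->
  forall (j : nat) (x : R), derivable (iterD j f) x 1.
Proof.
move=> sf j; elim: j f sf => [|j IH] f sf x; first by case: (sf 1%N).
have -> : iterD j.+1 f = iterD j (derive1 f) by rewrite /iterD iterSr.
by apply: IH => n; case: (sf n.+1).
Qed.

Lemma diff_upto_cst n (c : R) : diff_upto n (fun=> c).
Proof.
elim: n c => // n IH c; apply: diff_upto_S (IH 0) => x.
Qed.

Lemma diff_uptoD n f g : diff_upto n f -> diff_upto n g ->
  diff_upto n (fun x => f x + g x).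
Proof.
elim: n f g => // n IH f g df dg.
have [f1 f2] := (diff_upto_is_derive df, diff_upto_is_derive dg).
case: df => _ df; case: dg => _ dg.
apply: diff_upto_S (IH _ _ df dg) => x.
Qed.

Lemma diff_uptoM n f g : diff_upto n f -> diff_upto n g ->
  diff_upto n (fun x => f x * g x).
Proof.
elim: n f g => // n IH f g df dg.
have [f1 f2] := (diff_upto_is_derive df, diff_upto_is_derive dg).
have [f0 g0] := (diff_upto_pred df, diff_upto_pred dg).
case: df => _ df; case: dg => _ dg.
apply: diff_upto_S (diff_uptoD (IH _ _ f0 dg) (IH _ _ df g0)) => x.
by apply: is_derive_eq; rewrite /GRing.scale /= [g x * _]mulrC.
Qed.

Lemma diff_upto_affine n f (a c : R) : diff_upto n f ->
  diff_upto n (fun x => f (a * x + c)).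
Proof.
elim: n f => // n IH f df.
have f1 := diff_upto_is_derive df; case: df => _ df.
apply: diff_upto_S (diff_uptoM (diff_upto_cst n a) (IH _ df)) => x.
have H : is_derive x 1 (fun y : R => a * y + c) a.
  by apply: is_derive_eq; rewrite /GRing.scale /= addr0 mulr1 ?mulr0 ?add0r ?addr0.
have := @is_derive1_comp R f (fun y => a * y + c) x _ _ (f1 _) H.
by rewrite /comp mulrC.
Qed.

Lemma diff_uptoV n f : (forall x, f x != 0) -> diff_upto n f ->
  diff_upto n (fun x => (f x)^-1).
Proof.
move=> f0; elim: n => // n IH df.
have f1 := diff_upto_is_derive df.
have iv := IH (diff_upto_pred df).
case: df => _ df.
apply: diff_upto_S (diff_uptoM (diff_uptoM (diff_upto_cst n (-1)) (diff_uptoM iv iv)) df) => x.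
have f0x := f0 x.
have := is_deriveV f0x (f1 x).
move=> H; apply: is_derive_eq H _.
by rewrite /GRing.scale /= -exprVn mulN1r !mulNr expr2 [_^-1 / _]mulrC.
Qed.

(** The bound forces [f 0 = 0] and makes the difference quotient at 0 at most [K * |h|]. *)
Lemma is_derive_flat0 f (K : R) : (forall x, `|f x| <= K * x ^+ 2) ->
  is_derive (0:R) 1 f 0.
Proof.
move=> fK.
have f0 : f 0 = 0.
  by apply/normr0_eq0/le_anti; rewrite normr_ge0 andbT (le_trans (fK 0))// expr0n mulr0.
have K0 : 0 <= K by have := fK 1; rewrite expr1n mulr1; apply: le_trans.
have cv : (fun h : R => h^-1 *: ((f \o shift (0:R)) (h *: (1:R)) - f 0)) @ 0^' --> (0 : R).
  apply/cvgrPdist_lt => e e0.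
  near=> h.
  have h0 : h != 0 by near: h; exact: nbhs_dnbhs_neq.
  rewrite /= sub0r normrN addr0 f0 subr0 /GRing.scale /= mulr1 normrM normfV.
  apply: (@le_lt_trans _ _ (K * `|h|)).
    rewrite ler_pdivrMl ?normr_gt0 // mulrC -mulrA -expr2 real_normK ?num_real //.
  apply: (@le_lt_trans _ _ ((K + 1) * `|h|)); first by rewrite ler_wpM2r // lerDl.
  rewrite mulrC -ltr_pdivlMr ?ltr_wpDl //.
  near: h; apply: dnbhs0_lt; rewrite divr_gt0 // ltr_wpDl //.
apply: DeriveDef; first by apply/cvg_ex; exists 0.
exact/cvg_lim.
Unshelve. all: by end_near. Qed.

(** The functions [x^-n e^(-1/x)] form a family whose derivatives are combinations of members, so an
    induction proves all of them smooth at once. *)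
Definition flat_exp (n : nat) (x : R) : R :=
  if 0 < x then x ^- n * expR (- x^-1) else 0.

(** [expR y] is the power [m.+1] of [expR (y / m.+1)], which is at least [y / m.+1]. *)
Lemma pow_expRN_le m (y : R) : 0 <= y -> y ^+ m.+1 * expR (- y) <= m.+1%:R ^+ m.+1.
Proof.
move=> y0; rewrite expRN ler_pdivrMr ?expR_gt0 //.
have -> : expR y = expR (y / m.+1%:R) ^+ m.+1.
  by rewrite -expRM_natl mulrCA divff ?mulr1.
rewrite -exprMn; apply: lerXn2r.
- by rewrite nnegrE.
- by rewrite nnegrE mulr_ge0 ?expR_ge0.
rewrite -ler_pdivrMl ?ltr0n // mulrC.
apply: le_trans (expR_ge1Dx _); by rewrite lerDr.
Qed.

(** The previous bound at [1 / x] with exponent [n + 2] leaves the spare factor [x^2] that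
    [is_derive_flat0] asks for. *)
Lemma flat_exp_le n x : `|flat_exp n x| <= n.+2%:R ^+ n.+2 * x ^+ 2.
Proof.
rewrite /flat_exp; case: ifPn => x0; last by rewrite normr0 mulr_ge0 ?sqr_ge0 ?exprn_ge0.
rewrite ger0_norm ?mulr_ge0 ?invr_ge0 ?expR_ge0 ?exprn_ge0 ?(ltW x0) //.
have := @pow_expRN_le n.+1 x^-1; rewrite invr_ge0 => /(_ (ltW x0)) H.
rewrite -ler_pdivrMr ?exprn_gt0 //; apply: le_trans H.
by rewrite mulrAC -(addn2 n) exprD !exprVn.
Qed.

Lemma is_derive_flat_exp n (x : R) :
  is_derive x 1 (flat_exp n) (- n%:R * flat_exp n.+1 x + flat_exp n.+2 x).
Proof.
have [x0|x0|->] := ltgtP x 0.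
- apply: (@near_eq_is_derive R R R (fun=> 0)).
    near=> y; rewrite /flat_exp ifF //; apply/negbTE; rewrite -leNgt ltW //.
    by near: y; exact: lt_nbhsl.
  rewrite /flat_exp !ifF ?mulr0 ?addr0; last 2 first.
  + by apply/negbTE; rewrite -leNgt ltW.
  + by apply/negbTE; rewrite -leNgt ltW.
  exact: is_derive_cst.
- apply: (@near_eq_is_derive R R R (fun y => (y ^+ n)^-1 * expR (- y^-1))).
    near=> y; rewrite /flat_exp ifT //.
    by near: y; exact: lt_nbhsr.
  rewrite /flat_exp x0.
  have xn0 : x ^+ n != 0 by rewrite expf_neq0 // gt_eqF.
  have xx0 : x != 0 by rewrite gt_eqF.
  have d1 : is_derive x 1 (fun y : R => (y ^+ n)^-1) (- n%:R * x ^- n.+1).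
    have dn : is_derive x 1 (fun y : R => y ^+ n) (n%:R * x ^+ n.-1).
      have -> : (fun y : R => y ^+ n) = id ^+ n by apply/funext => y; rewrite exprfctE.
      by apply: is_derive_eq; rewrite /GRing.scale /= mulr1.
    have dV := @is_deriveV R (fun y : R => y ^+ n) x _ 1 xn0 dn.
    apply: is_derive_eq dV _.
    rewrite /GRing.scale /=; case: n {dn} xn0 => [|n] xn0; first by rewrite !mul0r oppr0 mulr0 mul0r.
    rewrite /= !mulNr; congr (- _); rewrite mulrCA; congr (_ * _).
    have xm0 : x ^+ n != 0 by rewrite expf_neq0.
    rewrite !exprS; field. by rewrite xx0 xm0.
  have d2 : is_derive x 1 (fun y : R => expR (- y^-1)) (x ^- 2 * expR (- x^-1)).
    have di : is_derive x 1 (fun y : R => - y^-1) (x ^- 2).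
      have dx := @is_derive_id R _ x 1.
      apply: is_derive_eq (is_deriveN (is_deriveV xx0 dx)) _.
      by rewrite /GRing.scale /= mulr1 opprK.
    have := @is_derive1_comp R expR (fun y => - y^-1) x _ _ (is_derive_expR _) di.
    by rewrite mulrC.
  apply: is_derive_eq (is_deriveM d1 d2) _.
  rewrite /GRing.scale /= !exprS; field. by rewrite xx0 xn0.
- rewrite /flat_exp ltxx mulr0 addr0; exact: is_derive_flat0 (@flat_exp_le n).
Unshelve. all: by end_near. Qed.

Lemma diff_upto_flat_exp k n : diff_upto k (flat_exp n).
Proof.
elim: k n => // k IH n.
apply: diff_upto_S (is_derive_flat_exp n) _.
exact: diff_uptoD (diff_uptoM (diff_upto_cst k _) (IH _)) (IH _).
Qed.

(** Never zero, since [x + 1] or [1 - x] is positive. The arguments are spelled [1 * x + 1] and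
    [-1 * x + 1] to fit [diff_upto_affine]. *)
Definition step_denom (x : R) : R := flat_exp 0 (1 * x + 1) + flat_exp 0 (-1 * x + 1).
Definition smooth_step (x : R) : R := flat_exp 0 (1 * x + 1) * (step_denom x)^-1.

Lemma flat_exp_ge0 n x : 0 <= flat_exp n x.
Proof.
rewrite /flat_exp; case: ifPn => // x0.
by rewrite mulr_ge0 ?invr_ge0 ?expR_ge0 ?exprn_ge0 // ltW.
Qed.

Lemma flat_exp_gt0 n x : 0 < x -> 0 < flat_exp n x.
Proof. by move=> x0; rewrite /flat_exp x0 mulr_gt0 ?invr_gt0 ?expR_gt0 ?exprn_gt0. Qed.

Lemma flat_exp_eq0 n x : x <= 0 -> flat_exp n x = 0.
Proof. by move=> x0; rewrite /flat_exp ltNge x0. Qed.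

Lemma step_denom_gt0 x : 0 < step_denom x.
Proof.
have [x0|x0] := leP x 0.
  by rewrite ltr_wpDl ?flat_exp_ge0 // flat_exp_gt0 //; lra.
by rewrite ltr_wpDr ?flat_exp_ge0 // flat_exp_gt0 //; lra.
Qed.

Lemma diff_upto_smooth_step n : diff_upto n smooth_step.
Proof.
apply: diff_uptoM; first exact/diff_upto_affine/diff_upto_flat_exp.
apply: diff_uptoV; first by move=> x; rewrite gt_eqF // step_denom_gt0.
by apply: diff_uptoD; exact/diff_upto_affine/diff_upto_flat_exp.
Qed.

Lemma smooth_step0 x : x <= -1 -> smooth_step x = 0.
Proof. by move=> x1; rewrite /smooth_step flat_exp_eq0 ?mul0r //; lra. Qed.

Lemma smooth_step1 x : 1 <= x -> smooth_step x = 1.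
Proof.
move=> x1; have := step_denom_gt0 x; rewrite /smooth_step /step_denom.
rewrite (@flat_exp_eq0 _ (-1 * x + 1)); last by lra.
by rewrite addr0 => /lt0r_neq0 ?; rewrite divff.
Qed.

Lemma smooth_step_itv x : 0 <= smooth_step x <= 1.
Proof.
rewrite /smooth_step mulr_ge0 ?flat_exp_ge0 ?invr_ge0 ?(ltW (step_denom_gt0 _)) //=.
rewrite ler_pdivrMr ?step_denom_gt0 // (mul1r (step_denom x)).
by rewrite /step_denom lerDl flat_exp_ge0.
Qed.

Lemma is_derive_smooth_step (x : R) : is_derive x 1 smooth_step (derive1 smooth_step x).
Proof. exact: diff_upto_is_derive (diff_upto_smooth_step 1) x. Qed.

Lemma derive1_smooth_step0 (x : R) : 1 < `|x| -> derive1 smooth_step x = 0.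
Proof.
move=> x1; rewrite derive1E; apply: derive_val.
have [x0|x0] := leP 0 x.
  apply: (@near_eq_is_derive R R R (fun=> 1)).
  near=> y; rewrite smooth_step1 //.
  by near: y; apply: (filterS _ (@lt_nbhsr R 1 x _)) => [z /ltW //|]; rewrite -(ger0_norm x0).
apply: (@near_eq_is_derive R R R (fun=> 0)).
near=> y; rewrite smooth_step0 //.
by near: y; apply: (filterS _ (@lt_nbhsl R x (-1) _)) => [z /ltW //|]; move: x1; rewrite ltr0_norm // => ?; lra.
Unshelve. all: by end_near. Qed.

Lemma is_derive_continuous f f' : (forall x : R, is_derive x 1 f (f' x)) -> continuous f.
Proof.
move=> d x; apply: differentiable_continuous.
by apply/derivable1_diffP; have := d x; case.
Qed.

Lemma continuous_derive1_smooth_step : continuous (derive1 smooth_step).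
Proof.
have [_ d] := diff_upto_smooth_step 2.
exact: is_derive_continuous (@diff_upto_is_derive 0 _ d).
Qed.

Lemma derive1_smooth_step_bounded :
  exists2 C : R, 0 < C & forall x, `|derive1 smooth_step x| <= C.
Proof.
have cn : continuous (fun x => `|derive1 smooth_step x|).
  by move=> x; apply: continuous_comp (@norm_continuous _ _ _); exact: continuous_derive1_smooth_step.
have [c _ Hc] := @EVT_max R (fun x => `|derive1 smooth_step x|) (-1) 1 ltac:(lra)
  (continuous_subspaceT cn).
exists (`|derive1 smooth_step c| + 1); first by rewrite ltr_wpDl.
move=> x; have [x1|x1] := leP `|x| 1.
  rewrite (le_trans (Hc x _)) ?lerDl // in_itv /=.
  by rewrite -ler_norml.
by rewrite derive1_smooth_step0 // normr0 addr_ge0.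
Qed.

End RealDerivatives.

(** * Square-integrable functions and their pairings *)

Section SquareIntegrable.
Variable R : realType.
Notation mu := (@lebesgue_measure R).
Implicit Types f g : R -> R.

Lemma L2_integrable_sq f : L2 f -> mu.-integrable setT (EFin \o (fun x => f x ^+ 2)).
Proof.
case=> mf foo; apply/integrableP; split.
  by apply/measurable_EFinP; exact: measurable_funX.
by under eq_integral do rewrite /= ger0_norm ?sqr_ge0 //.
Qed.

Lemma integrable_sq_L2 f : measurable_fun setT f ->
  mu.-integrable setT (EFin \o (fun x => f x ^+ 2)) -> L2 f.
Proof.
move=> mf /integrableP[_ foo]; split=> //; apply: le_lt_trans foo.
by under [leRHS]eq_integral do rewrite /= ger0_norm ?sqr_ge0 //.
Qed.

Lemma L2_int_sqE f : L2 f ->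
  (\int[mu]_x ((f x ^+ 2)%:E))%E = (\int[mu]_x (f x ^+ 2))%:E.
Proof.
move=> /L2_integrable_sq fi; rewrite /Rintegral fineK //.
exact: integrable_fin_num fi.
Qed.

Lemma int_sq_ge0 f : 0 <= \int[mu]_x (f x ^+ 2).
Proof. by apply: Rintegral_ge0 => x _; exact: sqr_ge0. Qed.

Lemma L2M_integrable f g : L2 f -> L2 g ->
  mu.-integrable setT (EFin \o (fun x => f x * g x)).
Proof.
move=> Lf Lg; case: (Lf) => mf _; case: (Lg) => mg _.
apply: (le_integrable _ _ _ (integrableD _ (L2_integrable_sq Lf) (L2_integrable_sq Lg))) => //.
  by apply/measurable_EFinP; exact: measurable_funM.
move=> x _ /=; rewrite lee_fin [leRHS]ger0_norm ?addr_ge0 ?sqr_ge0 // normrM.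
by rewrite -(real_normK (num_real (f x))) -(real_normK (num_real (g x))); nra.
Qed.

Lemma L2_cstM f (c : R) : L2 f -> L2 (fun x => c * f x).
Proof.
move=> Lf; case: (Lf) => mf _; apply: integrable_sq_L2; first exact: measurable_funM.
have := integrableZl measurableT (c ^+ 2) (L2_integrable_sq Lf).
apply: eq_integrable => // x _ /=; by rewrite exprMn EFinM.
Qed.

Lemma L2D f g : L2 f -> L2 g -> L2 (fun x => f x + g x).
Proof.
move=> Lf Lg; case: (Lf) => mf _; case: (Lg) => mg _.
apply: integrable_sq_L2; first exact: measurable_funD.
have := integrableD measurableT
  (integrableD measurableT (L2_integrable_sq Lf) (L2_integrable_sq Lg))
  (integrableZl measurableT 2 (L2M_integrable Lf Lg)).
apply: eq_integrable => // x _ /=; rewrite -!EFinM -!EFinD; congr (_%:E); ring.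
Qed.

Lemma L2_continuous_compact f (M : R) : continuous f ->
  (forall x, M < `|x| -> f x = 0) -> L2 f.
Proof.
move=> cf f0; apply: integrable_sq_L2; first exact: continuous_measurable_fun.
have cf2 : continuous (fun x => f x ^+ 2).
  by move=> x; apply: cvgM; exact: cf.
have := @continuous_compact_integrable R (fun x => f x ^+ 2) `[- M, M]
  (@segment_compact _ _ _) (continuous_subspaceT cf2).
move=> /(integrable_mkcond _ _).1 - /(_ (measurable_itv _)) H.
apply: eq_integrable H => // x _ /=; rewrite patchE; case: ifPn => //.
rewrite notin_setE /= in_itv /= => /negP; rewrite -ler_norml -ltNge => /f0 ->.
by rewrite expr0n.
Qed.

Lemma L2_indic (a b : R) : L2 (\1_(`[a, b]) : R -> R).
Proof.
apply: integrable_sq_L2; first exact: measurable_indic.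
have := @integrable_indic_itv R a b true false.
by apply: eq_integrable => // x _ /=; rewrite indicE; case: (_ \in _); rewrite ?expr1n ?expr0n.
Qed.

Lemma int_indic_sq (a b : R) : a <= b -> \int[mu]_x ((\1_(`[a, b]) x : R) ^+ 2) = b - a.
Proof.
move=> ab; transitivity (\int[mu]_x (\1_(`[a, b]) x : R)).
  apply: eq_Rintegral => x _.
  by rewrite indicE; case: (_ \in _); rewrite ?expr1n ?expr0n.
rewrite /Rintegral integral_indic //= setIT lebesgue_measure_itv /= lte_fin.
by case: ltgtP ab => [ab|//|->] _; rewrite ?subrr.
Qed.

Lemma L2_itv_integrable f (a b : R) : L2 f -> mu.-integrable `[a, b] (EFin \o f).
Proof.
move=> Lf; apply: (integrable_mkcond _ _).2; first exact: measurable_itv.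
have := L2M_integrable Lf (L2_indic a b).
by apply: eq_integrable => // x _ /=; rewrite patchE indicE; case: ifP => _; rewrite ?mulr1 ?mulr0.
Qed.

Lemma Rintegral_itv_indic f (a b : R) :
  \int[mu]_(x in `[a, b]) f x = \int[mu]_x (f x * \1_(`[a, b]) x).
Proof.
rewrite Rintegral_mkcond; apply: eq_Rintegral => x _.
by rewrite patchE indicE; case: ifP => _; rewrite ?mulr1 ?mulr0.
Qed.

(* The weighted AM-GM form of Cauchy-Schwarz; [K] is tuned by the caller. *)
Lemma L2_pairing_le f g (K : R) : 0 < K -> L2 f -> L2 g ->
  `|\int[mu]_x (f x * g x)| <=
  (\int[mu]_x (f x ^+ 2)) / K + K * \int[mu]_x (g x ^+ 2).
Proof.
move=> K0 Lf Lg.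
have fi := L2_integrable_sq Lf; have gi := L2_integrable_sq Lg.
have fgi := L2M_integrable Lf Lg.
apply: le_trans (le_normr_Rintegral measurableT fgi) _.
rewrite -RintegralZr // -RintegralZl // -RintegralD //; last 2 first.
- have := integrableZr measurableT K^-1 fi.
  by apply: eq_integrable => // x _.
- have := integrableZl measurableT K gi.
  by apply: eq_integrable => // x _.
apply: le_Rintegral => //.
- exact: (integrable_norm fgi).
- have := integrableD measurableT (integrableZr measurableT K^-1 fi) (integrableZl measurableT K gi).
  by apply: eq_integrable => // x _.
move=> x _; rewrite normrM -[f x ^+ 2](real_normK (num_real (f x))).
rewrite -[g x ^+ 2](real_normK (num_real (g x))).
move: (normr_ge0 (f x)) (normr_ge0 (g x)); move: `|f x| `|g x| => p q p0 q0.
rewrite -(ler_pM2r K0) mulrDl divfK ?gt_eqF //.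
have : 0 <= (p - K * q) ^+ 2 by exact: sqr_ge0.
have : 0 <= p * (K * q) by rewrite !mulr_ge0 // ltW.
by nra.
Qed.

Lemma L2_itv_le g (K a b : R) : 0 < K -> a <= b -> L2 g ->
  `|\int[mu]_(x in `[a, b]) g x| <= (\int[mu]_x (g x ^+ 2)) / K + K * (b - a).
Proof.
move=> K0 ab Lg; rewrite Rintegral_itv_indic.
apply: le_trans (L2_pairing_le K0 Lg (L2_indic a b)) _.
by rewrite int_indic_sq.
Qed.

End SquareIntegrable.

(** * Weak derivatives at Lebesgue points *)

Section WeakDerivatives.
Variable R : realType.
Notation mu := (@lebesgue_measure R).
Implicit Types f g : R -> R.

Lemma test_fun_continuous (phi : R -> R) j : test_fun phi -> continuous (iterD j phi).
Proof.
move=> [d _] x; apply: differentiable_continuous.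
by apply/derivable1_diffP; exact: d.
Qed.

Lemma test_fun_derive1 (phi : R -> R) : test_fun phi -> test_fun (derive1 phi).
Proof.
move=> [d [M phi0]]; split.
  by move=> j x; have := d j.+1 x; rewrite /iterD iterSr.
exists M => x Mx; rewrite derive1E; apply: derive_val.
apply: (@near_eq_is_derive R R R (fun=> 0)).
near=> y; rewrite phi0 //; near: y.
have : (fun y : R => `|y|) @ x --> `|x| by exact: norm_continuous.
move=> /cvgrPdist_lt /(_ (`|x| - M)); rewrite subr_gt0 => /(_ Mx).
apply: filterS => y /ltr_normlW; lra.
Unshelve. all: by end_near. Qed.

Lemma test_fun_L2 (phi : R -> R) : test_fun phi -> L2 phi.
Proof.
move=> tphi; have [_ [M phi0]] := tphi.
exact: L2_continuous_compact (@test_fun_continuous _ 0 tphi) phi0.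
Qed.

(** [D j] and [D j.+1] are tied only to [f]. Testing the first against [derive1 phi] and the second
    against [phi] gives the same integral of [f], with signs that differ by one factor -1. *)
Lemma weak_derivS k f D j : weak_derivs k f D -> (j < k)%N -> weak_deriv 1 (D j) (D j.+1).
Proof.
move=> [_ H] jk phi tphi.
have [_ H1] := H j.+1 jk; have [_ H0] := H j (ltnW jk).
have := H0 _ (test_fun_derive1 tphi).
have -> : iterD j (derive1 phi) = iterD j.+1 phi by rewrite /iterD iterSr.
rewrite H1 // exprS -mulrA mulN1r -mulrN => /mulfI E; rewrite expr1 mulN1r E //.
by rewrite signr_eq0.
Qed.

(** The step rescaled to climb on [[a - r, a + r]]; the argument [(x - a) / r] is kept in the affine
    form of [diff_upto_affine]. *)
Definition step_at (a r x : R) : R := smooth_step (r^-1 * x + - (a / r)).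

Definition step_at' (a r x : R) : R := r^-1 * derive1 (@smooth_step R) (r^-1 * x + - (a / r)).

Lemma step_atE (a r x : R) : r^-1 * x + - (a / r) = (x - a) / r.
Proof. by rewrite mulrBl [r^-1 * x]mulrC. Qed.

Lemma diff_upto_step_at a r n : diff_upto n (step_at a r).
Proof. exact/diff_upto_affine/diff_upto_smooth_step. Qed.

Lemma is_derive_step_at a r (x : R) : is_derive x 1 (step_at a r) (step_at' a r x).
Proof.
have H : is_derive x 1 (fun y : R => r^-1 * y + - (a / r)) r^-1.
  by apply: is_derive_eq; rewrite /GRing.scale /= oppr0 addr0 mulr1.
rewrite /step_at' mulrC.
exact: (@is_derive1_comp R (@smooth_step R) (fun y => r^-1 * y + - (a / r)) x _ _ (is_derive_smooth_step _) H).
Qed.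

Lemma step_at'_eq0 (a r x : R) : 0 < r -> r < `|x - a| -> step_at' a r x = 0.
Proof.
move=> r0 h; rewrite /step_at' step_atE derive1_smooth_step0 ?mulr0 //.
by rewrite normrM normfV (gtr0_norm r0) ltr_pdivlMr // mul1r.
Qed.

Lemma continuous_step_at' a r : continuous (step_at' a r).
Proof.
have := is_derive_continuous (@diff_upto_is_derive _ 0 _ (diff_upto_step_at a r 2).2).
by rewrite (derive1_ext (is_derive_step_at a r)).
Qed.

Lemma L2_step_at' a r : 0 < r -> L2 (step_at' a r).
Proof.
move=> r0; apply: (L2_continuous_compact (@continuous_step_at' a r) (M := `|a| + r)).
move=> x hx; apply: step_at'_eq0 => //.
have := ler_normB x (x - a); rewrite opprB addrCA subrr addr0 => h.
have := ler_normD (x - a) a; rewrite subrK; lra.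
Qed.

Lemma step_at_eq0 (a r x : R) : 0 < r -> x <= a - r -> step_at a r x = 0.
Proof. by move=> r0 h; rewrite /step_at step_atE smooth_step0 // ler_pdivrMr //; lra. Qed.

Lemma step_at_eq1 (a r x : R) : 0 < r -> a + r <= x -> step_at a r x = 1.
Proof. by move=> r0 h; rewrite /step_at step_atE smooth_step1 // ler_pdivlMr //; lra. Qed.

Lemma is_derive_step_diff (a b r x : R) :
  is_derive x 1 (fun y => step_at a r y + -1 * step_at b r y)
    (step_at' a r x - step_at' b r x).
Proof.
have d1 := is_derive_step_at a r x; have d2 := is_derive_step_at b r x.
by apply: is_derive_eq; rewrite /GRing.scale /=; ring.
Qed.

(** Off the two transition windows the smoothed indicator equals the true one. Everywhere their
    difference lies in [[-2, 1]], hence the factor 4. The windows may overlap, as when [a = b]. *)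
Lemma step_diff_le (a b r x : R) : 0 < r -> a <= b ->
  (step_at a r x + -1 * step_at b r x + -1 * (a <= x <= b)%R%:R) ^+ 2 <=
  4 * ((a - r <= x <= a + r)%R%:R + (b - r <= x <= b + r)%R%:R).
Proof.
move=> r0 ab; set s := step_at a r x + _; set L := (X in X <= _); set U := (X in _ <= X).
have /andP[sa0 sa1] := smooth_step_itv (r^-1 * x + - (a / r)).
have /andP[sb0 sb1] := smooth_step_itv (r^-1 * x + - (b / r)).
rewrite -/(step_at a r x) in sa0 sa1; rewrite -/(step_at b r x) in sb0 sb1.
have xI : L <= 4.
  by rewrite /L /s; case: (a <= x <= b); rewrite ?mulr1 ?mulr0; nra.
have U0 : 0 <= U by rewrite /U mulr_ge0 ?addr_ge0.
have out : L = 0 -> L <= U by move=> ->.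
have [h1|h1] := ltP x (a - r).
  apply: out; rewrite /L /s !step_at_eq0 //; try lra.
  have -> : (a <= x <= b) = false by apply/negbTE; rewrite negb_and -!ltNge; apply/orP; left; lra.
  by rewrite /=; ring.
have [h2|h2] := leP x (a + r).
  by rewrite (le_trans xI) // /U h1 h2 ler_peMr // lerDl.
have [h3|h3] := ltP x (b - r).
  apply: out; rewrite /L /s step_at_eq1 ?(ltW h2) // step_at_eq0 ?(ltW h3) //.
  have -> : (a <= x <= b) by apply/andP; split; lra.
  by rewrite /=; ring.
have [h4|h4] := leP x (b + r).
  by rewrite (le_trans xI) // /U h3 h4 ler_peMr // lerDr.
apply: out; rewrite /L /s !step_at_eq1 //; try lra.
have -> : (a <= x <= b) = false by apply/negbTE; rewrite negb_and -!ltNge; apply/orP; right; lra.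
by rewrite /=; ring.
Qed.

Lemma int_step_at' (a r : R) : 0 < r -> \int[mu]_(x in `[a - r, a + r]) step_at' a r x = 1.
Proof.
move=> r0; have ab : a - r < a + r by lra.
have cs := is_derive_continuous (is_derive_step_at a r).
rewrite /Rintegral (@continuous_FTC2 _ (step_at' a r) (step_at a r)) //=.
- by rewrite step_at_eq1 ?step_at_eq0 ?lexx // subr0.
- exact/continuous_subspaceT/continuous_step_at'.
- split; first by move=> x _; by case: (is_derive_step_at a r x).
  + exact/cvg_at_right_filter/cs.
  + exact/cvg_at_left_filter/cs.
by move=> x _; rewrite (derive1_ext (is_derive_step_at a r)).
Qed.

(** The closed interval lies in the open ball of radius [2 * r], whose measure is [4 * r]; this is
    why the average is taken below [e / 4]. *)
Lemma lebesgue_pt_int f (a e : R) : 0 < e -> measurable_fun setT f -> lebesgue_pt f a ->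
  exists2 d : R, 0 < d & forall r : R, 0 < r < d ->
  (\int[mu]_(x in `[(a - r)%R, (a + r)%R]) `|(f x - f a)%:E| <= (r * e)%:E)%E.
Proof.
move=> e0 mf /fine_cvgP [fi /cvgrPdist_lt /(_ (e / 4)) fa].
have e4 : 0 < e / 4 by lra.
have [d /= d0 H] := filterI fi (fa e4).
exists (d / 2); first by lra.
move=> r /andP[r0 rd].
have r20 : 0 < 2 * r by lra.
have [] := H (2 * r); [by rewrite /= sub0r normrN gtr0_norm //; lra|by []|].
rewrite sub0r normrN.
rewrite ger0_norm; last by apply: fine_ge0; exact: davg_ge0.
move=> dfi dlt.
have mB : measurable (ball a (2 * r)) by exact: measurable_ball.
have mg : measurable_fun (ball a (2 * r)) (fun x => `|(f x - f a)%:E|)%E.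
  apply: measurableT_comp => //; apply/measurable_EFinP.
  by apply: measurable_funB => //; apply: measurable_funS mf.
apply: (@le_trans _ _ (\int[mu]_(x in ball a (2 * r)) `|(f x - f a)%:E|)%E).
  apply: ge0_subset_integral => //.
  by move=> x /=; rewrite in_itv /= ball_itv /= in_itv /= => /andP[? ?]; apply/andP; split; lra.
have -> : (\int[mu]_(x in ball a (2 * r)) `|(f x - f a)%:E|)%E = ((4 * r)%:E * davg f a (2 * r))%E.
  rewrite /davg /iavg lebesgue_measure_ball; last by lra.
  have r40 : 4 * r != 0 by rewrite gt_eqF //; lra.
  have -> : 2 * r *+ 2 = 4 * r by ring.
  rewrite inver (negbTE r40) muleA -EFinM divff // mul1e.
  by [].
rewrite -(fineK dfi) -EFinM lee_fin.
nra.
Qed.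

(* [step_at' a r] is an approximate identity at [a] as [r] tends to 0. *)
Lemma mollify_lebesgue_pt f (a e : R) : 0 < e -> L2 f -> lebesgue_pt f a ->
  exists2 d : R, 0 < d & forall r : R, 0 < r < d ->
  `|\int[mu]_x (f x * step_at' a r x) - f a| <= e.
Proof.
move=> e0 Lf fa; have [C C0 HC] := @derive1_smooth_step_bounded R.
(* The kernel is at most [C / r], and [|f - f a|] integrates over the window to at most
   [r * (e / C)]; the product is [e]. *)
have eC : 0 < e / C by rewrite divr_gt0.
have [d d0 H] := lebesgue_pt_int eC Lf.1 fa.
exists d => // r rd; have /andP[r0 _] := rd.
have Lk := L2_step_at' a r0.
have -> : \int[mu]_x (f x * step_at' a r x) =
          \int[mu]_(x in `[a - r, a + r]) (f x * step_at' a r x).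
  rewrite [RHS]Rintegral_mkcond; apply: eq_Rintegral => x _.
  rewrite patchE; case: ifPn => //.
  rewrite notin_setE /= in_itv /= => /negP xI; rewrite step_at'_eq0 ?mulr0 //.
  by rewrite ltNge; apply: contra xI; rewrite ler_distl.
have ik := L2_itv_integrable (a - r) (a + r) Lk.
have ifk : mu.-integrable `[a - r, a + r] (EFin \o (fun x => f x * step_at' a r x)).
  by apply: integrableS (L2M_integrable Lf Lk).
have ic (c : R) : mu.-integrable `[a - r, a + r] (EFin \o (fun=> c)).
  apply: (@continuous_compact_integrable R (fun=> c)); first exact: segment_compact.
  by apply: continuous_subspaceT => x; exact: cvg_cst.
have iff : mu.-integrable `[a - r, a + r] (EFin \o (fun x => f x - f a)).
  by apply: (integrableB _ (L2_itv_integrable (a - r) (a + r) Lf) (ic (f a))).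
have icf : mu.-integrable `[a - r, a + r] (EFin \o (fun x => f a * step_at' a r x)).
  by apply: (integrableZl _ (f a) ik).
(* The kernel has total mass 1, so [f a] is turned into an integral against it. *)
rewrite -[X in _ - X]mulr1 -(int_step_at' a r0) -RintegralZl // -RintegralB //.
have ig : mu.-integrable `[a - r, a + r] (EFin \o (fun x => f x * step_at' a r x - f a * step_at' a r x)).
  by apply: (integrableB _ ifk icf).
apply: le_trans (le_normr_Rintegral _ ig) _ => //.
have ia := integrable_norm iff.
have iaC : mu.-integrable `[a - r, a + r] (EFin \o (fun x => (C / r) * `|f x - f a|)).
  by apply: (integrableZl _ (C / r) ia).
apply: le_trans (le_Rintegral _ (integrable_norm ig) iaC _) _ => //.
  move=> x _ /=; rewrite -mulrBl normrM mulrC ler_wpM2r // /step_at' normrM mulrC.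
  by rewrite normfV (gtr0_norm r0) ler_wpM2r // invr_ge0 ltW.
rewrite RintegralZl //.
have h : \int[mu]_(x in `[a - r, a + r]) `|f x - f a| <= r * (e / C).
  rewrite -lee_fin; apply: le_trans (H _ rd).
  rewrite /Rintegral fineK; last exact: integrable_fin_num ia.
  by [].
apply: le_trans (ler_wpM2l _ h) _; first by rewrite divr_ge0 ?ltW.
rewrite le_eqVlt; apply/orP; left; apply/eqP; field.
by rewrite !gt_eqF.
Qed.

(** The error count of [weak_deriv1_int]: [A] and [B] are the mollified values at the endpoints, [P]
    is the pairing of [g] with the test function, [I] the integral of [g]. Four errors of [e / 4]
    add up to [e]. *)
Lemma approx_increment (A B P I X Y p q e : R) :
  `|A - p| <= e / 4 -> `|B - q| <= e / 4 -> A - B = - P ->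
  `|P - I| <= X + Y -> X <= e / 4 -> Y <= e / 4 -> `|q - p - I| <= e.
Proof.
rewrite !ler_norml => /andP[? ?] /andP[? ?] ? /andP[? ?] ? ?.
by apply/andP; split; lra.
Qed.

(* Test against a smoothed indicator of [a, b], with transition width [r]. *)
Lemma weak_deriv1_int f g (a b : R) : L2 f -> L2 g -> weak_deriv 1 f g ->
  a <= b -> lebesgue_pt f a -> lebesgue_pt f b ->
  f b - f a = \int[mu]_(x in `[a, b]) g x.
Proof.
move=> Lf Lg fg ab fa fb.
pose G := \int[mu]_x (g x ^+ 2).
have G0 : 0 <= G := int_sq_ge0 g.
apply/eqP; rewrite -subr_eq0 -normr_le0; apply/ler_addgt0Pl => e e0; rewrite addr0.
have e4 : 0 < e / 4 by lra.
have [da da0 Ha] := mollify_lebesgue_pt e4 Lf fa.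
have [db db0 Hb] := mollify_lebesgue_pt e4 Lf fb.
(* [K] is fixed before [r]: it brings the [g] term below [e / 4], and the [+ 1] keeps it positive
   when [G] is 0. Then [r] is taken small against [K]; [16 * r] is the factor 4 of [step_diff_le]
   times two windows of length [2 * r]. *)
pose K := (G + 1) * 4 / e.
have K0 : 0 < K by rewrite divr_gt0 // mulr_gt0 //; lra.
have [r r0 [rda rdb rK]] : exists2 r : R, 0 < r & [/\ r < da, r < db & K * (16 * r) <= e / 4].
  exists (Num.min (Num.min (da / 2) (db / 2)) (e / (64 * K))).
    by rewrite !lt_min !divr_gt0 // mulr_gt0.
  split.
  - by rewrite !gt_min; apply/orP; left; apply/orP; left; lra.
  - by rewrite !gt_min; apply/orP; left; apply/orP; right; lra.
  - set m := Num.min _ _; have : m <= e / (64 * K) by rewrite /m ge_min lexx orbT.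
    rewrite ler_pdivlMr; last lra.
    move=> h; lra.
have {}Ha := Ha r; have {}Hb := Hb r; rewrite r0 rda in Ha; rewrite r0 rdb in Hb.
have {}Ha := Ha isT; have {}Hb := Hb isT.
pose phi x := step_at a r x + -1 * step_at b r x.
have sphi n : diff_upto n phi.
  exact: diff_uptoD (diff_upto_step_at _ _ _) (diff_uptoM (diff_upto_cst _ _) (diff_upto_step_at _ _ _)).
have phi0 x : x <= a - r -> phi x = 0.
  by move=> h; rewrite /phi !step_at_eq0 ?mulr0 ?addr0 //; lra.
have phi1 x : b + r <= x -> phi x = 0.
  by move=> h; rewrite /phi !step_at_eq1 ?mulr1 ?subrr //; lra.
have tphi : test_fun phi.
  split; first exact: diff_upto_iterD.
  exists (`|a| + `|b| + r) => x hx.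
  have [x0|x0] := leP 0 x.
    by rewrite phi1 //; move: hx; rewrite (ger0_norm x0); have := ler_norm b; have := normr_ge0 a; lra.
  rewrite phi0 //; move: hx; rewrite (ltr0_norm x0); have := lerNnormlW (lexx `|a|); have := normr_ge0 b; lra.
have dphi (x : R) : is_derive x 1 phi (step_at' a r x - step_at' b r x) :=
  is_derive_step_diff a b r x.
have ika := L2M_integrable Lf (L2_step_at' a r0).
have ikb := L2M_integrable Lf (L2_step_at' b r0).
have := fg _ tphi; rewrite /iterD /= (derive1_ext dphi) expr1 mulN1r.
under eq_Rintegral do rewrite mulrBr.
rewrite (RintegralB measurableT ika ikb) => E.
have Lphi := test_fun_L2 tphi.
have Lchi : L2 (fun x => phi x + -1 * \1_(`[a, b]) x).
  exact: L2D Lphi (L2_cstM _ (L2_indic _ _)).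
have E2 : \int[mu]_x (g x * phi x) - \int[mu]_(x in `[a, b]) g x =
    \int[mu]_x (g x * (phi x + -1 * \1_(`[a, b]) x)).
  rewrite Rintegral_itv_indic -RintegralB //; last 2 first.
  - exact: L2M_integrable Lg Lphi.
  - exact: L2M_integrable Lg (L2_indic a b).
  by apply: eq_Rintegral => x _; ring.
have := L2_pairing_le K0 Lg Lchi; rewrite -E2 -/G => H.
have hchi : \int[mu]_x ((phi x + -1 * \1_(`[a, b]) x) ^+ 2) <= 16 * r.
  have i1 := L2_integrable_sq (L2_indic (a - r) (a + r)).
  have i2 := L2_integrable_sq (L2_indic (b - r) (b + r)).
  have sqi (c d x : R) : (\1_(`[c, d]) x : R) ^+ 2 = \1_(`[c, d]) x.
    by rewrite indicE; case: (_ \in _); rewrite ?expr1n ?expr0n.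
  have i12 := integrableZl measurableT 4 (integrableD measurableT i1 i2).
  apply: (@le_trans _ _ (\int[mu]_x (4 * ((\1_(`[a - r, a + r]) x) ^+ 2 + (\1_(`[b - r, b + r]) x) ^+ 2)))).
    apply: le_Rintegral => //; first exact: L2_integrable_sq.
    move=> x _; rewrite !sqi !indicE !mem_setE !in_itv /=.
    exact: step_diff_le.
  rewrite RintegralZl //; last exact: (integrableD measurableT i1 i2).
  rewrite RintegralD //.
  have [ar br] : a - r <= a + r /\ b - r <= b + r by clear -r0; split; lra.
  rewrite (int_indic_sq ar) (int_indic_sq br) (_ : 4 * _ = 16 * r) //; ring.
have hK : G / K <= e / 4.
  rewrite ler_pdivrMr // (_ : e / 4 * K = G + 1) ?lerDl //.
  by rewrite /K; field; rewrite gt_eqF.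
have hK2 := ler_wpM2l (ltW K0) hchi.
exact: approx_increment Ha Hb E H hK (le_trans hK2 rK).
Qed.

End WeakDerivatives.

(** * Sobolev embedding *)

Section Sobolev.
Variable R : realType.
Notation mu := (@lebesgue_measure R).
Implicit Types f g F G : R -> R.

Lemma L2_locally_integrable f : L2 f -> locally_integrable [set: R] f.
Proof.
move=> Lf; split; [exact: Lf.1|exact: openT|].
move=> K _ cK; have [M [_ HM]] := compact_bounded cK.
have {}HM x : K x -> `|x| <= M + 1 by apply: HM; rewrite ltrDl.
have /integrableP[mf foo] := L2_itv_integrable (- (M + 1)) (M + 1) Lf.
apply: le_lt_trans foo; apply: ge0_subset_integral => //.
- exact: compact_measurable.
- by do 2 apply: measurableT_comp => //; exact: measurable_funTS Lf.1.
- by move=> x /HM; rewrite /= in_itv /= ler_norml.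
Qed.

(** A ball has positive measure, so it cannot lie in the exceptional null set. *)
Lemma ae_dense (P : R -> Prop) : (\forall x \ae mu, P x) ->
  forall x e : R, 0 < e -> exists2 y, `|x - y| < e & P y.
Proof.
move=> [N [mN N0 PN]] x e e0; apply: contrapT => H.
have sub : ball x e `<=` N.
  by move=> y xy; apply: PN => Py; apply: H; exists y.
have : (mu (ball x e) <= mu N)%E.
  by apply: le_measure => //; rewrite inE //; exact: measurable_ball.
by rewrite N0 lebesgue_measure_ball ?(ltW e0) // lee_fin -mulr_natl leNgt mulr_gt0.
Qed.

Lemma continuous_ae_eq F G : continuous F -> continuous G ->
  (\forall x \ae mu, F x = G x) -> F = G.
Proof.
move=> cF cG FG; apply/funext => x; apply/eqP; rewrite -subr_eq0.
apply/negP => /negP H.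
have e0 : 0 < `|F x - G x| by rewrite normr_gt0.
have cFG : continuous (fun y => F y - G y) by move=> y; apply: cvgB; [exact: cF|exact: cG].
have /cvgrPdist_lt /(_ _ e0) [d /= d0 Hd] := cFG x.
have [y xy FGy] := ae_dense FG x d0.
by have := Hd y xy; rewrite FGy subrr subr0 ltxx.
Qed.

Lemma ae_imply (P Q : R -> Prop) : (forall x, P x -> Q x) ->
  (\forall x \ae mu, P x) -> \forall x \ae mu, Q x.
Proof. by move=> PQ; apply: filterS => //; exact: (ae_filter_ringOfSetsType mu). Qed.

Lemma ae_imply2 (P Q S : R -> Prop) : (forall x, P x -> Q x -> S x) ->
  (\forall x \ae mu, P x) -> (\forall x \ae mu, Q x) -> \forall x \ae mu, S x.
Proof. by move=> PQ; apply: filterS2 => //; exact: (ae_filter_ringOfSetsType mu). Qed.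

Lemma Rintegral_ae_eq f g (D : set (measurableTypeR R)) : measurable D -> measurable_fun D f -> measurable_fun D g ->
  (\forall x \ae mu, f x = g x) -> \int[mu]_(x in D) f x = \int[mu]_(x in D) g x.
Proof.
move=> mD mf mg fg; rewrite /Rintegral; congr fine; apply: ae_eq_integral => //.
- exact/measurable_EFinP.
- exact/measurable_EFinP.
by apply: ae_imply fg => x -> _.
Qed.

Lemma L2_ae_eq f g : L2 f -> measurable_fun setT g -> (\forall x \ae mu, f x = g x) -> L2 g.
Proof.
move=> [mf foo] mg fg; split=> //.
suff <- : (\int[mu]_x ((f x ^+ 2)%:E) = \int[mu]_x ((g x ^+ 2)%:E))%E by [].
apply: ae_eq_integral => //.
- by apply/measurable_EFinP; exact: measurable_funX.
- by apply/measurable_EFinP; exact: measurable_funX.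
by apply: ae_imply fg => x -> _.
Qed.

Lemma Rintegral_itv_cat g (a b c : R) : a <= b -> b <= c -> L2 g ->
  \int[mu]_(x in `[a, c]) g x = \int[mu]_(x in `[a, b]) g x + \int[mu]_(x in `[b, c]) g x.
Proof.
move=> ab bc Lg; have ig := L2_itv_integrable a c Lg.
have := @Rintegral_itvB R g (BLeft a) (BRight c) b ig.
rewrite !bnd_simp ab bc => /(_ isT isT).
rewrite Rintegral_itv_obnd_cbnd; first by move=> <-; rewrite addrC subrK.
apply: integrableS (L2_itv_integrable b c Lg) => //.
by move=> x /=; rewrite !in_itv /= => /andP[/ltW -> ->].
Qed.

Lemma Rintegral_itv_ge g (a b : R) : b <= a -> \int[mu]_(x in `[a, b]) g x = 0.
Proof.
rewrite le_eqVlt => /predU1P[->|ba]; first by rewrite set_itv1 Rintegral_set1.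
by rewrite set_itv_ge ?Rintegral_set0 // bnd_simp -ltNge.
Qed.

Lemma increment_continuous F g : L2 g ->
  (forall a b, a <= b -> F b - F a = \int[mu]_(x in `[a, b]) g x) -> continuous F.
Proof.
move=> Lg dF x; apply/cvgrPdist_lt => e e0.
set G := \int[mu]_x (g x ^+ 2).
have G0 : 0 <= G := int_sq_ge0 g.
have G1 : 0 < G + 1 by rewrite ltr_wpDl.
pose K := (G + 1) * 2 / e.
have K0 : 0 < K by rewrite divr_gt0 // mulr_gt0.
have key a b : a <= b -> K * (b - a) < e / 2 -> `|F b - F a| < e.
  move=> ab h; rewrite dF //; apply: le_lt_trans (L2_itv_le K0 ab Lg) _.
  rewrite -/G [e]splitr; apply: ler_ltD => //.
  rewrite ler_pdivrMr // (_ : e / 2 * K = G + 1) ?lerDl //.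
  by rewrite /K; field; rewrite gt_eqF.
near=> y.
have h : K * `|x - y| < e / 2.
  rewrite mulrC -ltr_pdivlMr //; near: y.
  have : 0 < e / 2 / K by rewrite divr_gt0 // divr_gt0.
  by move=> d0; exists (e / 2 / K).
have [xy|yx] := leP x y.
  by rewrite distrC; apply: key => //; move: h; rewrite distrC ger0_norm ?subr_ge0.
by apply: key; [exact: ltW|move: h; rewrite gtr0_norm ?subr_gt0].
Unshelve. all: by end_near. Qed.

(** Integrate [g] from a base point [c] that is a Lebesgue point of [f]. By [weak_deriv1_int] the
    result agrees with [f] at every Lebesgue point, and almost every point is one. *)
Lemma continuous_representative f g : L2 f -> L2 g -> weak_deriv 1 f g ->
  exists F, [/\ continuous F, \forall x \ae mu, f x = F x &
    forall a b, a <= b -> F b - F a = \int[mu]_(x in `[a, b]) g x].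
Proof.
move=> Lf Lg fg.
have aef := lebesgue_differentiation (L2_locally_integrable Lf).
have [c _ fc] := ae_dense aef 0 ltr01.
(* An oriented integral from [c] to [x]: one of the two intervals is always empty or a point. *)
pose F x := f c + (\int[mu]_(y in `[c, x]) g y - \int[mu]_(y in `[x, c]) g y).
have dF a b : a <= b -> F b - F a = \int[mu]_(x in `[a, b]) g x.
  move=> ab; rewrite /F.
  have [ca|ac] := leP c a.
    rewrite (Rintegral_itv_ge _ ca) (Rintegral_itv_ge _ (le_trans ca ab)).
    rewrite (Rintegral_itv_cat ca ab Lg); ring.
  have [cb|bc] := leP c b.
    rewrite (Rintegral_itv_ge _ cb) (Rintegral_itv_ge _ (ltW ac)).
    rewrite (Rintegral_itv_cat (ltW ac) cb Lg); ring.
  rewrite (Rintegral_itv_ge _ (ltW ac)) (Rintegral_itv_ge _ (ltW bc)).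
  rewrite (Rintegral_itv_cat ab (ltW bc) Lg); ring.
exists F; split => //; first exact: increment_continuous Lg dF.
apply: ae_imply aef => x fx; rewrite /F.
have [cx|xc] := leP c x.
  by rewrite (Rintegral_itv_ge _ cx) subr0 -(weak_deriv1_int Lf Lg fg cx fc fx) addrC subrK.
rewrite (Rintegral_itv_ge _ (ltW xc)) sub0r -(weak_deriv1_int Lf Lg fg (ltW xc) fx fc); ring.
Qed.

(** Near [x] the function [F] is a constant plus the integral of [G] from [x - 1], to which the
    fundamental theorem applies. *)
Lemma increment_is_derive F g G (x : R) : L2 g -> continuous G -> (\forall x \ae mu, g x = G x) ->
  (forall a b, a <= b -> F b - F a = \int[mu]_(x in `[a, b]) g x) ->
  is_derive x 1 F (G x).
Proof.
move=> Lg cG gG dF.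
have iG : mu.-integrable `[x - 1, x + 1] (EFin \o G).
  apply: (@continuous_compact_integrable R G); first exact: segment_compact.
  exact: continuous_subspaceT.
have [|||d1 d2] := @continuous_FTC1_closed R G (x - 1) x (x + 1) _ iG; [lra|lra|exact: cG|].
apply: (@near_eq_is_derive R R R (fun y => F (x - 1) + \int[mu]_(z in `[x - 1, y]) G z)).
  near=> y.
  rewrite -(Rintegral_ae_eq (f := g)).
  - rewrite -dF; first by rewrite addrC subrK.
    by apply: ltW; near: y; apply: lt_nbhsr; lra.
  - exact: measurable_itv.
  - by apply: measurable_funS Lg.1.
  - by apply: measurable_funTS; exact: continuous_measurable_fun.
  - exact: gG.
have dI : is_derive x 1 (fun y => \int[mu]_(z in `[x - 1, y]) G z) (G x).
  by rewrite -d2 derive1E; apply/derivableP.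
rewrite -[G x]add0r; exact: (is_deriveD (is_derive_cst (F (x - 1)) x 1) dI).
Unshelve. all: by end_near. Qed.

(* If [|F x| > 3 e] then [|F| > e] on [x, x + 1], contradicting [int F^2 < e^2]. *)
Lemma increment_bound F g (e x : R) : 0 < e -> L2 F -> L2 g ->
  (forall a b, a <= b -> F b - F a = \int[mu]_(x in `[a, b]) g x) ->
  \int[mu]_x (F x ^+ 2) < e ^+ 2 -> \int[mu]_x (g x ^+ 2) < e ^+ 2 -> `|F x| <= 3 * e.
Proof.
move=> e0 LF Lg dF F2 g2; rewrite leNgt; apply/negP => Fx.
have Fy y : x <= y <= x + 1 -> e <= `|F y|.
  move=> /andP[xy yx].
  (* With weight [e] both terms are at most [e], so [F] moves by at most [2 * e] on the unit
     interval and [3 * e] leaves [e]. *)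
  have := L2_itv_le e0 xy Lg; rewrite -dF // => h.
  have h1 : (\int[mu]_x (g x ^+ 2)) / e <= e by rewrite ler_pdivrMr // -expr2 ltW.
  have h2 : e * (y - x) <= e by rewrite ler_piMr ?(ltW e0) //; lra.
  have := ler_normB (F y) (F y - F x); rewrite opprB addrCA subrr addr0 => h3.
  by lra.
move: F2; rewrite ltNge => /negP; apply.
have x1 : x <= x + 1 by rewrite lerDl.
have -> : e ^+ 2 = e ^+ 2 * \int[mu]_y ((\1_(`[x, x + 1]) y : R) ^+ 2).
  by rewrite int_indic_sq // addrAC subrr add0r mulr1.
have i1 := L2_integrable_sq (L2_indic x (x + 1)).
rewrite -RintegralZl //; apply: le_Rintegral => //.
- exact: (integrableZl _ (e ^+ 2) i1).
- exact: L2_integrable_sq.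
move=> y _; rewrite indicE mem_setE /= in_itv /=.
have [h|h] := boolP (x <= y <= x + 1); last by rewrite expr0n mulr0 sqr_ge0.
rewrite expr1n mulr1 -(real_normK (num_real (F y))).
by apply: lerXn2r; rewrite ?nnegrE ?(ltW e0) // Fy.
Qed.

(** Induction on [j]: the continuous representative of [D j.+1] can replace it in the increment
    formula of [iterD j f], so it is the classical derivative. The top order [k.+1] is spent, as it
    only serves as an integrand. *)
Lemma weak_derivs_classical k f D : weak_derivs k.+1 f D -> continuous f ->
  forall j, (j <= k)%N -> [/\ continuous (iterD j f),
    \forall x \ae mu, D j x = iterD j f x &
    forall a b, a <= b -> iterD j f b - iterD j f a = \int[mu]_(x in `[a, b]) D j.+1 x].
Proof.
move=> wD cf.
have step j : (j <= k)%N -> continuous (iterD j f) -> (\forall x \ae mu, D j x = iterD j f x) ->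
    forall a b, a <= b -> iterD j f b - iterD j f a = \int[mu]_(x in `[a, b]) D j.+1 x.
  move=> jk cj Dj.
  have [F [cF DF dF]] := continuous_representative (wD.2 j (leqW jk)).1 (wD.2 j.+1 jk).1 (weak_derivS wD jk).
  suff -> : iterD j f = F by [].
  by apply: continuous_ae_eq => //; apply: ae_imply2 Dj DF => x <- <-.
elim=> [|j IH] jk.
  have D0 : \forall x \ae mu, D 0%N x = iterD 0 f x by apply: aeW => x; exact: wD.1.
  by split=> //; exact: step.
have [cj Dj dj] := IH (ltnW jk).
have jk1 : (j.+1 < k.+1)%N by [].
have [F [cF DF dF]] := continuous_representative (wD.2 j.+1 (leqW jk)).1 (wD.2 j.+2 jk1).1 (weak_derivS wD jk1).
have E : iterD j.+1 f = F.
  apply: (derive1_ext (f := iterD j f)) => x.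
  exact: increment_is_derive (wD.2 j.+1 (leqW jk)).1 cF DF dj.
by rewrite E; split.
Qed.

Lemma Hk_is_derive k f : Hk k.+1 f -> continuous f ->
  forall j, (j < k)%N -> forall x : R, is_derive x 1 (iterD j f) (iterD j.+1 f x).
Proof.
move=> [D wD] cf j jk x.
have [cj Dj dj] := weak_derivs_classical wD cf (ltnW jk).
have [cj1 Dj1 _] := weak_derivs_classical wD cf jk.
exact: increment_is_derive (wD.2 j.+1 (leqW jk)).1 cj1 Dj1 dj.
Qed.

(** [increment_bound] uses the square integrals of orders [j] and [j.+1], each a single summand of
    the norm. *)
Lemma Hk_norm_lt_bound k f (e : R) : 0 < e -> Hk_norm_lt k.+1 f e -> continuous f ->
  forall j x, (j <= k)%N -> `|iterD j f x| <= 3 * e.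
Proof.
move=> e0 [D [wD De]] cf j x jk.
have Dj i : (i <= k.+1)%N -> \int[mu]_x (D i x ^+ 2) < e ^+ 2.
  move=> ik; rewrite -lte_fin -L2_int_sqE; last exact: (wD.2 i ik).1.
  have ik2 : (i < k.+2)%N by [].
  apply: le_lt_trans De; rewrite (bigD1 (Ordinal ik2)) //= leeDl //.
  by apply: sume_ge0 => m _; apply: integral_ge0 => y _; rewrite lee_fin sqr_ge0.
have [cj Djj dj] := weak_derivs_classical wD cf jk.
have [mD _] := (wD.2 j (leqW jk)).1.
have mj : measurable_fun setT (iterD j f) by exact: continuous_measurable_fun.
have Djj2 : \forall x \ae mu, D j x ^+ 2 = iterD j f x ^+ 2 by apply: ae_imply Djj => y ->.
have Lj : L2 (iterD j f) by exact: L2_ae_eq (wD.2 j (leqW jk)).1 mj Djj.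
apply: (increment_bound x e0 Lj (wD.2 j.+1 jk).1 dj); last exact: Dj.
rewrite -(Rintegral_ae_eq (f := fun x => D j x ^+ 2)) //.
- exact/Dj/leqW.
- exact: measurable_funX.
- exact: measurable_funX.
Qed.

Lemma Hk_norm_finite k f : Hk k f -> exists2 e : R, 0 < e & Hk_norm_lt k f e.
Proof.
move=> [D wD].
pose S := \sum_(j < k.+1) \int[mu]_x (D j x ^+ 2).
have S0 : 0 <= S by apply: sumr_ge0 => i _; exact: int_sq_ge0.
(* [S] is the squared norm, and [S < (1 + S)^2] gives a positive bound without a square root. *)
exists (1 + S); first by rewrite ltr_wpDr.
exists D; split=> //.
have -> : (\sum_(j < k.+1) \int[mu]_x (D j x ^+ 2)%:E = S%:E)%E.
  rewrite /S -sumEFin; apply: eq_bigr => i _; apply: L2_int_sqE.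
  by apply: (wD.2 i _).1; rewrite -ltnS.
by rewrite lte_fin; nra.
Qed.

End Sobolev.

(** * Regularity in time *)

Section TimeRegularity.
Variable R : realType.
Notation mu := (@lebesgue_measure R).
Implicit Types f g : R -> R.

(** Weak derivatives see [f] only through integrals, so the entry of order 0 alone is replaced. This
    carries norm bounds over to continuous representatives, where sup bounds are available. *)
Lemma Hk_norm_lt_ae_eq k f g (e : R) : measurable_fun setT g ->
  (\forall x \ae mu, f x = g x) -> Hk_norm_lt k f e -> Hk_norm_lt k g e.
Proof.
move=> mg fg [D [[D0 wD] De]].
have fD0 : D 0%N = f by apply/funext.
have Lf : L2 f by rewrite -fD0; exact: (wD 0%N isT).1.
have Lg := L2_ae_eq Lf mg fg.
exists (fun j => if j is 0%N then g else D j); split; last first.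
  apply: le_lt_trans De; rewrite !big_ord_recl /= fD0; apply: leeD => //.
  rewrite !L2_int_sqE // lee_fin le_eqVlt; apply/orP; left; apply/eqP.
  apply: Rintegral_ae_eq => //.
  - exact: measurable_funX.
  - exact: measurable_funX Lf.1.
  - by apply: ae_imply fg => x ->.
split=> // -[_|j jk].
  by split=> // phi _; rewrite expr0 mul1r.
split; first exact: (wD j.+1 jk).1.
move=> phi tphi; rewrite -((wD j.+1 jk).2 phi tphi).
have mphi : measurable_fun setT (iterD j.+1 phi).
  exact: continuous_measurable_fun (@test_fun_continuous _ _ _ tphi).
apply: Rintegral_ae_eq => //.
- exact: measurable_funM.
- exact: measurable_funM Lf.1 mphi.
- by apply: ae_imply fg => x ->.
Qed.

Lemma Hk_ae_eq k f g : measurable_fun setT g -> (\forall x \ae mu, f x = g x) -> Hk k f -> Hk k g.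
Proof.
move=> mg fg /Hk_norm_finite[e e0 /(Hk_norm_lt_ae_eq mg fg)[D [wD _]]].
by exists D.
Qed.

Lemma Hk_continuous_representative k f : Hk k.+1 f ->
  exists F, continuous F /\ \forall x \ae mu, f x = F x.
Proof.
move=> [D wD].
have [F [cF DF _]] := continuous_representative (wD.2 0%N isT).1 (wD.2 1%N isT).1 (weak_derivS wD (ltn0Sn k)).
exists F; split=> //; apply: ae_imply DF => x <-.
by rewrite wD.1.
Qed.

(** [derive1] is linear where the derivatives exist. Coefficients [1], [-1] treat differences of two
    times; a further factor [c] treats difference quotients. *)
Lemma iterD_lin k f g (a b : R) :
  (forall j, (j < k)%N -> forall x : R, is_derive x 1 (iterD j f) (iterD j.+1 f x)) ->
  (forall j, (j < k)%N -> forall x : R, is_derive x 1 (iterD j g) (iterD j.+1 g x)) ->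
  forall j, (j <= k)%N ->
  iterD j (fun x => a * f x + b * g x) = (fun x => a * iterD j f x + b * iterD j g x).
Proof.
move=> df dg; elim=> // j IH jk.
have -> : iterD j.+1 (fun x => a * f x + b * g x) = derive1 (iterD j (fun x => a * f x + b * g x)) by [].
rewrite IH ?(ltnW jk) //; apply: derive1_ext => x.
have h1 := df j jk x; have h2 := dg j jk x.
by apply: is_derive_eq; rewrite /GRing.scale /=; ring.
Qed.

Lemma is_derive_quotient (f : R -> R) (l t : R) :
  (forall e : R, 0 < e -> exists2 d : R, 0 < d & forall s, s != t -> `|s - t| < d ->
    `|(f s - f t) / (s - t) - l| <= e) -> is_derive t 1 f l.
Proof.
move=> H.
have cv : (fun h : R => h^-1 *: ((f \o shift t) (h *: (1:R)) - f t)) @ 0^' --> l.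
  apply/cvgrPdist_le => e e0; have [d d0 Hd] := H e e0.
  near=> h.
  have h0 : h != 0 by near: h; exact: nbhs_dnbhs_neq.
  have hd : `|h| < d by near: h; exact: dnbhs0_lt.
  have := Hd (h + t); rewrite addrK -subr_eq0 addrK => /(_ h0 hd).
  by rewrite distrC /GRing.scale /= mulr1 [_ / h]mulrC.
apply: DeriveDef; first by apply/cvg_ex; exists l.
exact/cvg_lim.
Unshelve. all: by end_near. Qed.

(** Compare [g x t] with [g y s] through [g y t]: the move in time is uniform in space, so
    continuity in [x] at the single time [t] is enough. *)
Lemma uniform_continuous_strip (T : R) (g : R -> R -> R) :
  (forall t, 0 < t < T -> continuous (fun x => g x t)) ->
  (forall t, 0 < t < T -> forall e : R, 0 < e -> exists2 d : R, 0 < d &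
    forall s, 0 < s < T -> `|s - t| < d -> forall x, `|g x s - g x t| <= e) ->
  {within strip T, continuous (fun p : R * R => g p.1 p.2)}.
Proof.
move=> cx ct; apply: continuous_in_subspaceT => -[x t].
rewrite inE /strip /= => -[t0 tT].
have tI : 0 < t < T by rewrite t0.
apply/cvgrPdist_lt => e e0.
have e2 : 0 < e / 2 by lra.
have e4 : 0 < e / 4 by lra.
have [d d0 Hd] := ct t tI _ e4.
have /cvgrPdist_lt /(_ _ e2) Hx := cx t tI x.
have Ht : \forall s \near t, [/\ 0 < s, s < T & `|s - t| < d].
  near=> s; split.
  - by near: s; exact: lt_nbhsr.
  - by near: s; exact: lt_nbhsl.
  - by near: s; exists d => //= s; rewrite distrC.
have H : \forall p \near ((x, t) : R * R), `|g x t - g p.1 t| < e / 2 /\ [/\ 0 < p.2, p.2 < T & `|p.2 - t| < d].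
  exists ([set y | `|g x t - g y t| < e / 2], [set s | [/\ 0 < s, s < T & `|s - t| < d]]); first by split.
  by move=> -[y s] [].
apply: filterS H => -[y s] /= [h1 [s0 sT sd]].
have := Hd s; rewrite s0 sT => /(_ isT sd y) h2.
have := ler_distD (g y t) (g x t) (g y s); rewrite [`|g y t - g y s|]distrC; lra.
Unshelve. all: by end_near. Qed.

End TimeRegularity.

Section inB_regularity.
Variables (R : realType) (T : R) (u : R -> R -> R).
Hypothesis uB : inB T u.

Lemma inB_is_derive t : in_time T t -> forall j, (j < 3)%N ->
  forall x : R, is_derive x 1 (iterD j (fun y => u y t)) (iterD j.+1 (fun y => u y t) x).
Proof.
move=> tT j j3 x; have [cu [Hu _]] := uB.
exact: Hk_is_derive (Hu t tT) (cu t tT) j j3 x.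
Qed.

Lemma inB_L2 t : in_time T t -> L2 (fun y => u y t).
Proof.
move=> tT; have [cu [Hu _]] := uB; have [D wD] := Hu t tT.
have -> : (fun y => u y t) = D 0%N by apply/funext => x; rewrite wD.1.
exact: (wD.2 0%N isT).1.
Qed.

Lemma inB_bounded t : in_time T t -> exists M : R,
  forall j x, (j <= 3)%N -> `|iterD j (fun y => u y t) x| <= M.
Proof.
move=> tT; have [cu [Hu _]] := uB.
have [e e0 He] := Hk_norm_finite (Hu t tT).
exists (3 * e) => j x j3; exact: Hk_norm_lt_bound e0 He (cu t tT) j x j3.
Qed.

Lemma inB_uniform_continuous t (e : R) : in_time T t -> 0 < e ->
  exists2 d : R, 0 < d & forall s, in_time T s -> `|s - t| < d ->
  forall j x, (j <= 3)%N -> `|iterD j (fun y => u y s) x - iterD j (fun y => u y t) x| <= e.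
Proof.
move=> tT e0; have [cu [Hu [ut _]]] := uB.
have e3 : 0 < e / 3 by lra.
have [d [d0 Hd]] := ut t tT _ e3.
exists d => // s sT std j x j3.
have E : (fun y => u y s - u y t) = (fun y => 1 * u y s + -1 * u y t).
  by apply/funext => y; rewrite mul1r mulN1r.
have := Hd s sT std; rewrite E => /(Hk_norm_lt_bound e3) H.
have cE : continuous (fun y => 1 * u y s + -1 * u y t).
  by rewrite -E => y; apply: cvgB; [exact: cu|exact: cu].
have := H cE j x j3.
rewrite (iterD_lin 1 (-1) (inB_is_derive sT) (inB_is_derive tT) j3) mul1r mulN1r.
lra.
Qed.

(** The map [v] of the space takes values in H^3 without being assumed continuous in [x]; [V t] is
    its continuous representative. Difference quotients in time commute with [d_x^j], so their H^3
    convergence becomes uniform convergence of the quotients of [d_x^j u]. The last clause is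
    two-sided in time, hence [0 < t]. *)
Lemma inB_time_derivative : exists V : R -> R -> R,
  [/\ forall t, in_time T t -> forall j, (j < 2)%N ->
        forall x : R, is_derive x 1 (iterD j (V t)) (iterD j.+1 (V t) x),
      forall t, in_time T t -> exists M : R, forall j x, (j <= 2)%N -> `|iterD j (V t) x| <= M,
      forall t (e : R), in_time T t -> 0 < e ->
        exists2 d : R, 0 < d & forall s, in_time T s -> `|s - t| < d ->
        forall j x, (j <= 2)%N -> `|iterD j (V s) x - iterD j (V t) x| <= e &
      forall t : R, 0 < t < T -> forall j (x : R), (j <= 2)%N ->
        is_derive t 1 (fun s => iterD j (fun y => u y s) x) (iterD j (V t) x)].
Proof.
have [cu [Hu [_ [v [Hv [vt qt]]]]]] := uB.
have /choice [V HV] : forall t, exists F : R -> R, in_time T t ->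
    continuous F /\ \forall x \ae (@lebesgue_measure R), v t x = F x.
  move=> t; have [tT|ntT] := pselect (in_time T t); last by exists (fun=> 0) => /ntT.
  by have [F HF] := Hk_continuous_representative (Hv t tT); exists F.
have cV t : in_time T t -> continuous (V t) by move=> /HV[].
have mV t : in_time T t -> measurable_fun setT (V t).
  by move=> /cV; exact: continuous_measurable_fun.
have HkV t : in_time T t -> Hk 3 (V t).
  by move=> tT; exact: Hk_ae_eq (mV t tT) (HV t tT).2 (Hv t tT).
have dV t : in_time T t -> forall j, (j < 2)%N ->
        forall x : R, is_derive x 1 (iterD j (V t)) (iterD j.+1 (V t) x).
  by move=> tT j j2 x; exact: Hk_is_derive (HkV t tT) (cV t tT) j j2 x.
exists V; split => //.
- move=> t tT; have [e e0 He] := Hk_norm_finite (HkV t tT).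
  exists (3 * e) => j x j2; exact: Hk_norm_lt_bound e0 He (cV t tT) j x j2.
- move=> t e tT e0; have e3 : 0 < e / 3 by lra.
  have [d [d0 Hd]] := vt t tT _ e3.
  exists d => // s sT std j x j2.
  have E : (fun y => V s y - V t y) = (fun y => 1 * V s y + -1 * V t y).
    by apply/funext => y; rewrite mul1r mulN1r.
  have cE : continuous (fun y => 1 * V s y + -1 * V t y).
    by rewrite -E => y; apply: cvgB; [exact: cV|exact: cV].
  have mE : measurable_fun setT (fun y => 1 * V s y + -1 * V t y).
    exact: continuous_measurable_fun.
  have aeE : \forall x \ae (@lebesgue_measure R), v s x - v t x = 1 * V s x + -1 * V t x.
    apply: ae_imply2 (HV s sT).2 (HV t tT).2 => y -> ->; by rewrite mul1r mulN1r.
  have := Hk_norm_lt_bound e3 (Hk_norm_lt_ae_eq mE aeE (Hd s sT std)) cE x j2.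
  rewrite (iterD_lin 1 (-1) (dV s sT) (dV t tT) j2) mul1r mulN1r; lra.
move=> t /andP[t0 tT] j x j2.
have tI : in_time T t by split=> //; exact: ltW.
apply: is_derive_quotient => e e0; have e3 : 0 < e / 3 by lra.
have [d [d0 Hd]] := qt t tI _ e3.
(* The last two bounds keep [s] inside the time interval. *)
exists (Num.min d (Num.min t (T - t))).
  by rewrite !lt_min d0 t0 subr_gt0.
move=> s st; rewrite !lt_min => /and3P[sd s1 s2].
have sI : in_time T s by move: s1 s2; rewrite !ltr_norml => /andP[? ?] /andP[? ?]; split; lra.
set c := (s - t)^-1.
have E y : c * (1 * u y s + -1 * u y t) + -1 * V t y = (u y s - u y t) / (s - t) - V t y.
  by rewrite -/c; ring.
have cE : continuous (fun y => c * (1 * u y s + -1 * u y t) + -1 * V t y).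
  move=> y; apply: cvgD; apply: cvgMr; last exact: cV.
  by apply: cvgD; apply: cvgMr; exact: cu.
have mE : measurable_fun setT (fun y => c * (1 * u y s + -1 * u y t) + -1 * V t y).
  exact: continuous_measurable_fun.
have aeE : \forall x \ae (@lebesgue_measure R), (u x s - u x t) / (s - t) - v t x =
    c * (1 * u x s + -1 * u x t) + -1 * V t x.
  by apply: ae_imply (HV t tI).2 => y ->; rewrite E.
have := Hk_norm_lt_bound e3 (Hk_norm_lt_ae_eq mE aeE (Hd s sI st sd)) cE x j2.
have du r : in_time T r -> forall j, (j < 2)%N ->
    forall x : R, is_derive x 1 (iterD j (fun y => u y r)) (iterD j.+1 (fun y => u y r) x).
  by move=> rI i i2; apply: inB_is_derive => //; exact: ltnW.
have dw : forall j, (j < 2)%N -> forall x : R,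
    is_derive x 1 (iterD j (fun y => 1 * u y s + -1 * u y t)) (iterD j.+1 (fun y => 1 * u y s + -1 * u y t) x).
  move=> i i2 y; rewrite !(iterD_lin 1 (-1) (du s sI) (du t tI)) // ?(ltnW i2) //.
  have h1 := du s sI i i2 y; have h2 := du t tI i i2 y.
  by apply: is_derive_eq; rewrite /GRing.scale /=; ring.
rewrite (iterD_lin c (-1) dw (dV t tI) j2) (iterD_lin 1 (-1) (du s sI) (du t tI) j2).
rewrite (_ : _ + _ = (iterD j (fun y => u y s) x - iterD j (fun y => u y t) x) / (s - t) - iterD j (V t) x); first lra.
by rewrite -/c; ring.
Qed.

End inB_regularity.

(** * The non-local term *)

Section BoundedSolution.
Variable R : realType.

Lemma is_derive_expRN (x : R) : is_derive x 1 (fun y : R => expR (- y)) (- expR (- x)).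
Proof.
have di : is_derive x 1 (fun y : R => - y) (-1) by apply: is_derive_eq.
have := @is_derive1_comp R expR (fun y => - y) x _ _ (is_derive_expR _) di.
by rewrite mulrN1.
Qed.

(** If [C] is not 0, then [1 + x <= expR x] at [x = K / |C|] already gives a value of at least
    [|C| + K]. *)
Lemma exp_dominated_eq0 (C K : R) : (forall x, 0 <= x -> `|C| * expR x <= K) -> C = 0.
Proof.
move=> H; apply/eqP; rewrite -normr_le0 leNgt; apply/negP => C0.
have K0 : 0 <= K by apply: le_trans (H 0 (lexx _)); rewrite mulr_ge0 ?expR_ge0.
have x0 : 0 <= K / `|C| by rewrite divr_ge0.
have := H _ x0; rewrite leNgt => /negP; apply.
have h : `|C| * (1 + K / `|C|) <= `|C| * expR (K / `|C|).
  by rewrite ler_wpM2l // expR_ge1Dx.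
apply: lt_le_trans h; rewrite mulrDr mulr1 mulrC divfK ?gt_eqF // ltrDr //.
Qed.

(* [w' + w] and [w' - w] solve first-order equations, so [w] is a combination
   of [e^x] and [e^-x]. *)
Lemma bounded_second_order_eq0 (w w1 : R -> R) (M : R) :
  (forall x : R, is_derive x 1 w (w1 x)) -> (forall x : R, is_derive x 1 w1 (w x)) ->
  (forall x, `|w x| <= M) -> forall x, w x = 0.
Proof.
move=> dw dw1 wM.
have cA x : expR (- x) * (w1 x + w x) = w1 0 + w 0.
  have -> : w1 0 + w 0 = expR (- 0) * (w1 0 + w 0) by rewrite oppr0 expR0 mul1r.
  apply: (@is_derive_0_is_cst R (fun y => expR (- y) * (w1 y + w y))) => y.
  have h : is_derive y 1 (fun z => w1 z + w z) (w y + w1 y) := is_deriveD (dw1 y) (dw y).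
  apply: is_derive_eq (is_deriveM (is_derive_expRN y) h) _.
  by rewrite /GRing.scale /=; ring.
have cB x : expR x * (w1 x - w x) = w1 0 - w 0.
  have -> : w1 0 - w 0 = expR 0 * (w1 0 - w 0) by rewrite expR0 mul1r.
  apply: (@is_derive_0_is_cst R (fun y => expR y * (w1 y - w y))) => y.
  have h : is_derive y 1 (fun z => w1 z - w z) (w y - w1 y) := is_deriveB (dw1 y) (dw y).
  apply: is_derive_eq (is_deriveM (is_derive_expR y) h) _.
  by rewrite /GRing.scale /=; ring.
set C := w1 0 + w 0 in cA; set D := w1 0 - w 0 in cB.
have wE x : 2 * w x = C * expR x - D * expR (- x).
  rewrite -(cA x) -(cB x) !(mulrC (expR _)) -!mulrA -!expRD subrr addNr expR0; ring.
have e1 x : 0 <= x -> expR (- x) <= 1 by move=> x0; rewrite expR_le1 oppr_le0.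
have M2 x : `|2 * w x| <= 2 * M by rewrite normrM ger0_norm // ler_wpM2l.
(* For [x >= 0] the term in [e^-x] is at most [|D|], so [C e^x] stays bounded. The same argument at
   [- x] disposes of [D]. *)
have C0 : C = 0.
  apply: (@exp_dominated_eq0 _ (2 * M + `|D|)) => x x0.
  rewrite -[X in _ * X](ger0_norm (expR_ge0 x)) -normrM.
  have -> : C * expR x = 2 * w x + D * expR (- x) by rewrite wE subrK.
  apply: le_trans (ler_normD _ _) _; rewrite lerD // normrM (ger0_norm (expR_ge0 _)).
  by rewrite ler_piMr // e1.
have D0 : D = 0.
  apply: (@exp_dominated_eq0 _ (2 * M + `|C|)) => x x0.
  rewrite -[X in _ * X](ger0_norm (expR_ge0 x)) -normrM.
  have -> : D * expR x = C * expR (- x) - 2 * w (- x) by rewrite wE opprK; ring.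
  apply: le_trans (ler_normB _ _) _; rewrite addrC lerD // normrM (ger0_norm (expR_ge0 _)).
  by rewrite ler_piMr // e1.
move=> x; have := wE x; rewrite C0 D0 !mul0r subrr => /eqP.
by rewrite mulf_eq0 pnatr_eq0 /= => /eqP.
Qed.

End BoundedSolution.

Section GreenFunction.
Variables (R : realType) (g : R -> R).
Notation mu := (@lebesgue_measure R).
Hypotheses (cg : continuous g) (ig : mu.-integrable setT (EFin \o g)).

Let eA (y : R) := expR y * g y.
Let eB (y : R) := expR (- y) * g y.

Let ceA : continuous eA.
Proof. by move=> y; apply: cvgM; [exact: continuous_expR|exact: cg]. Qed.

Let ceB : continuous eB.
Proof.
move=> y; apply: cvgM; last exact: cg.
by apply: continuous_comp; [exact: opp_continuous|exact: continuous_expR].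
Qed.

Let integrable_weight (i : interval R) (e : R -> R) (K : R) : continuous e ->
  (forall y, y \in i -> `|e y| <= K) ->
  mu.-integrable [set` i] (EFin \o (fun y => e y * g y)).
Proof.
move=> ce eK.
have ii : mu.-integrable [set` i] (EFin \o g) by apply: integrableS ig.
have ceg : continuous (fun y => e y * g y).
  by move=> y; apply: cvgM; [exact: ce|exact: cg].
apply: (le_integrable _ _ _ (integrableZl _ K ii)) => //.
  apply/measurable_EFinP; apply: measurable_funTS.
  exact: continuous_measurable_fun.
move=> y yi /=; rewrite lee_fin !normrM ler_wpM2r //.
by apply: le_trans (eK y yi) (ler_norm _).
Qed.

Let ieA (x : R) b : mu.-integrable [set` Interval -oo%O (BSide b x)] (EFin \o eA).
Proof.
apply: (integrable_weight (K := expR x)); first exact: continuous_expR.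
move=> y; rewrite in_itv /= => yx; rewrite ger0_norm ?expR_ge0 // ler_expR.
by apply: lteifW yx.
Qed.

Let ieB (x : R) b : mu.-integrable [set` Interval (BSide b x) +oo%O] (EFin \o eB).
Proof.
apply: (integrable_weight (e := fun y => expR (- y)) (K := expR (- x))).
  by move=> y; apply: continuous_comp; [exact: opp_continuous|exact: continuous_expR].
move=> y; rewrite in_itv /= andbT => yx; rewrite ger0_norm ?expR_ge0 // ler_expR lerN2.
by apply: lteifW yx.
Qed.

(** On either side of [y = x] the kernel factors into a function of [x] and one of [y]. The
    derivative then falls on explicit exponentials and on integration limits instead of on a kernel
    with a jump. *)
Let A (x : R) := \int[mu]_(y in `]-oo, x]) eA y.
Let B (x : R) := \int[mu]_(y in `]x, +oo[) eB y.

Let dA (x : R) : is_derive x 1 A (expR x * g x).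
Proof.
have [|||d1 d2] := @continuous_FTC1 R eA -oo%O x (x + 1) _ (ieA (x + 1) false).
- by rewrite ltrDl.
- by rewrite ltNyr.
- exact: ceA.
- by rewrite -/(eA x) -d2 derive1E; apply/derivableP.
Qed.

(** The fundamental theorem differentiates in the upper limit, so near [x] the tail is written as
    [B (x - 1)] minus an integral starting at [x - 1]. *)
Let dB (x : R) : is_derive x 1 B (- (expR (- x) * g x)).
Proof.
have iI : mu.-integrable `](x - 1), (x + 1)] (EFin \o eB).
  apply: integrableS (ieB (x - 1) false) => //.
  by move=> y /=; rewrite !in_itv /= => /andP[-> _].
have [|||d1 d2] := @continuous_FTC1 R eB (BRight (x - 1)) x (x + 1) _ iI.
- by rewrite ltrDl.
- by rewrite lte_fin ltrBlDr ltrDl.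
- exact: ceB.
apply: (@near_eq_is_derive R R R (fun y => B (x - 1) - \int[mu]_(z in `](x - 1), y]) eB z)).
  near=> y; rewrite /B.
  rewrite (@Rintegral_itvB R eB (BRight (x - 1)) +oo%O y (ieB (x - 1) false)) //.
  rewrite bnd_simp ltW //; near: y; apply: lt_nbhsr; lra.
have dI : is_derive x 1 (fun y => \int[mu]_(z in `](x - 1), y]) eB z) (eB x).
  by rewrite -d2 derive1E; apply/derivableP.
have h := is_deriveB (is_derive_cst (B (x - 1)) x (1 : R)) dI.
rewrite sub0r in h; exact: h.
Unshelve. all: by end_near. Qed.

(** Both half-lines are open, so both restrictions vanish at [y = x], as does [Gp] there because
    [Num.sg 0 = 0]; [GpE] thus holds at every [y]. *)
Let restrA (x : R) := eA \_ (`]-oo, x[%classic).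
Let restrB (x : R) := eB \_ (`]x, +oo[%classic).

Let GpE (x y : R) :
  Gp (x - y) * g y = (- (1 / 2) * expR (- x)) * restrA x y + (1 / 2 * expR x) * restrB x y.
Proof.
have p0 : (point : R) = 0 by [].
rewrite /restrA /restrB !patchE !mem_setE !in_itv /= andbT /Gp /eA /eB.
have [xy|yx|->] := ltgtP x y; rewrite ?p0.
- rewrite ltr0_sg ?subr_lt0 // ltr0_norm ?subr_lt0 // opprK expRD; ring.
- rewrite gtr0_sg ?subr_gt0 // gtr0_norm ?subr_gt0 // opprB addrC expRD; ring.
- rewrite subrr sgr0; ring.
Qed.

Let irestrA x : mu.-integrable setT (EFin \o restrA x).
Proof.
have := ieA x true; move=> /(integrable_mkcond _ _).1 - /(_ (measurable_itv _)).
by apply: eq_integrable => // y _ /=; rewrite /restrA !patchE; case: ifP.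
Qed.

Let irestrB x : mu.-integrable setT (EFin \o restrB x).
Proof.
have := ieB x false; move=> /(integrable_mkcond _ _).1 - /(_ (measurable_itv _)).
by apply: eq_integrable => // y _ /=; rewrite /restrB !patchE; case: ifP.
Qed.

Lemma dxLambdam2E x : dxLambdam2 g x = - (1 / 2) * expR (- x) * A x + 1 / 2 * expR x * B x.
Proof.
rewrite /dxLambdam2; under eq_Rintegral do rewrite GpE.
rewrite RintegralD //; last 2 first.
- exact: (integrableZl _ _ (irestrA x)).
- exact: (integrableZl _ _ (irestrB x)).
rewrite (RintegralZl _ measurableT (irestrA x)) (RintegralZl _ measurableT (irestrB x)).
congr (_ + _); congr (_ * _).
  by rewrite /restrA -Rintegral_mkcond Rintegral_itv_bndo_bndc.
by rewrite /restrB -Rintegral_mkcond.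
Qed.

(** [|Gp| <= 1 / 2], so half the L1 norm of [g] is a bound; in use [g] is [u^2], integrable since
    [u] is in L2. *)
Lemma dxLambdam2_bounded : exists M : R, forall x, `|dxLambdam2 g x| <= M.
Proof.
exists (1 / 2 * \int[mu]_x `|g x|) => x.
have iGp : mu.-integrable setT (EFin \o (fun y => Gp (x - y) * g y)).
  have := integrableD measurableT
    (integrableZl measurableT (- (1 / 2) * expR (- x)) (irestrA x))
    (integrableZl measurableT (1 / 2 * expR x) (irestrB x)).
  by apply: eq_integrable => // y _; rewrite /= GpE.
apply: le_trans (le_normr_Rintegral _ iGp) _ => //.
have ia := integrable_norm ig.
rewrite -RintegralZl //; apply: le_Rintegral => //.
- exact: (integrable_norm iGp).
- exact: (integrableZl _ _ ia).
move=> y _; rewrite normrM ler_wpM2r // /Gp !normrM normrN.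
have h2 : `|1 / 2 : R| = 1 / 2 by rewrite ger0_norm //; lra.
rewrite (ger0_norm (expR_ge0 _)) h2.
rewrite -mulrA ler_piMr //.
apply: mulr_ile1; rewrite ?expR_ge0 // ?expR_le1 ?oppr_le0 //.
by rewrite normr_sg; case: eqP.
Qed.

(* [p] is [Lambda^-2 g]. *)
Lemma dxLambdam2_is_derive : exists p : R -> R,
  forall x : R, is_derive x 1 (dxLambdam2 g) (p x - g x) /\ is_derive x 1 p (dxLambdam2 g x).
Proof.
exists (fun x => 1 / 2 * expR (- x) * A x + 1 / 2 * expR x * B x) => x.
have dE (c : R) : is_derive x 1 (fun y : R => c * expR (- y)) (- c * expR (- x)).
  apply: is_derive_eq (is_deriveM (is_derive_cst c x 1) (is_derive_expRN x)) _.
  by rewrite /GRing.scale /=; ring.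
have dF (c : R) : is_derive x 1 (fun y : R => c * expR y) (c * expR x).
  apply: is_derive_eq (is_deriveM (is_derive_cst c x 1) (is_derive_expR x)) _.
  by rewrite /GRing.scale /=; ring.
split.
  rewrite (_ : dxLambdam2 g = (fun y => - (1 / 2) * expR (- y) * A y + 1 / 2 * expR y * B y)); last first.
    by apply/funext => y; exact: dxLambdam2E.
  (* The two boundary terms are [- g x / 2] each and add up to [- g x], the jump of the kernel. In
     the derivative of [p] they cancel. *)
  apply: is_derive_eq (is_deriveD (is_deriveM (dE _) (dA x)) (is_deriveM (dF _) (dB x))) _.
  rewrite /GRing.scale /=.
  rewrite expRN; field; by rewrite gt_eqF ?expR_gt0.
rewrite dxLambdam2E.
apply: is_derive_eq (is_deriveD (is_deriveM (dE _) (dA x)) (is_deriveM (dF _) (dB x))) _.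
rewrite /GRing.scale /= expRN; field; by rewrite gt_eqF ?expR_gt0.
Qed.

End GreenFunction.

(** * The Degasperis-Procesi forms *)

Section DefectDerivatives.
Variables (R : realType) (x : R) (a a1 a2 a3 v v1 v2 h p : R -> R).
Hypotheses (da : is_derive x 1 a (a1 x)) (da1 : is_derive x 1 a1 (a2 x)).
Hypotheses (da2 : is_derive x 1 a2 (a3 x)).

Lemma is_derive_flux :
  is_derive x 1 (fun y => a1 y ^+ 2 - 2 * a y * a1 y + a y * a2 y)
    (3 * a1 x * a2 x + a x * a3 x - 2 * a1 x ^+ 2 - 2 * a x * a2 x).
Proof. by apply: is_derive_eq; rewrite /GRing.scale /=; ring. Qed.

Hypotheses (dv : is_derive x 1 v (v1 x)) (dv1 : is_derive x 1 v1 (v2 x)).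
Hypotheses (dh : is_derive x 1 h (p x - a x ^+ 2)) (dp : is_derive x 1 p (h x)).

(** [a] to [a3] stand for [u] and its x-derivatives at a fixed time, [v] to [v2] for those of [u_t],
    [h] for [G' * u^2] and [p] for [G * u^2]. Keeping them abstract leaves [ring] with plain
    variables. *)
Lemma is_derive_nonlocal :
  is_derive x 1 (fun y => v y + a y * a1 y + (3 / 2) * h y)
    (v1 x + (a1 x * a1 x + a x * a2 x) + (3 / 2) * (p x - a x ^+ 2)).
Proof. by apply: is_derive_eq; rewrite /GRing.scale /=; ring. Qed.

Lemma is_derive2_nonlocal :
  is_derive x 1 (fun y => v1 y + (a1 y * a1 y + a y * a2 y) + (3 / 2) * (p y - a y ^+ 2))
    (v2 x + (3 * (a1 x * a2 x) + a x * a3 x) + (3 / 2) * (h x - 2 * a x * a1 x)).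
Proof. by apply: is_derive_eq; rewrite /GRing.scale /=; ring. Qed.

End DefectDerivatives.

(** The [h] terms cancel, and [3 / 2] times [2 a a1] joins the transport term [a a1] to give the
    coefficient 4. *)
Lemma nonlocal_defect (R : realType) (v v2 a a1 a2 a3 h : R) :
  (v + a * a1 + (3 / 2) * h) - (v2 + (3 * (a1 * a2) + a * a3) + (3 / 2) * (h - 2 * a * a1)) =
  v - v2 + 4 * a * a1 - (3 * a1 * a2 + a * a3).
Proof. by field. Qed.

(** The part [2 F] cancels the terms [a1^2] and [a a2] of the derivative of [F] and contributes
    [- 4 a a1]. *)
Lemma flux_defect (R : realType) (a a1 a2 a3 v v2 : R) :
  3 * a1 * a2 + a * a3 - 2 * a1 ^+ 2 - 2 * a * a2 - (v - v2) +
    2 * (a1 ^+ 2 - 2 * a * a1 + a * a2) =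
  3 * a1 * a2 + a * a3 - (v - v2 + 4 * a * a1).
Proof. by ring. Qed.

Section DegasperisProcesi.
Variables (R : realType) (T : R) (u : R -> R -> R).
Hypothesis uB : inB T u.

Let in_time_lt (t : R) : 0 < t < T -> in_time T t.
Proof. by case/andP => /ltW t0 tT; split. Qed.

Lemma inB_C1_strip : C1_strip T u.
Proof.
have [V [dV Vb Vc dt]] := inB_time_derivative uB.
have u1 (x t : R) : 0 < t < T -> is_derive x 1 (fun y : R => u y t) (pdx u x t).
  by move=> tT; exact: (inB_is_derive uB (in_time_lt tT) (j := 0) isT x).
have ut (x t : R) : 0 < t < T -> is_derive t 1 (fun s : R => u x s) (V t x).
  by move=> tT; exact: (dt t tT 0 x isT).
have utE (x t : R) : 0 < t < T -> pdt u x t = V t x.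
  by move=> tT; rewrite /pdt derive1E; have h := ut x t tT; apply: derive_val.
split; first by move=> x t tT; have h1 := u1 x t tT; have h2 := ut x t tT; split; [case: h1|case: h2].
split.
  apply: uniform_continuous_strip => t tT.
    exact: is_derive_continuous (inB_is_derive uB (in_time_lt tT) (j := 0) isT).
  move=> e e0; have [d d0 Hd] := inB_uniform_continuous uB (in_time_lt tT) e0.
  by exists d => // s sT st x; exact: (Hd s (in_time_lt sT) st 0%N x).
split.
  apply: uniform_continuous_strip => t tT.
    exact: is_derive_continuous (inB_is_derive uB (in_time_lt tT) (j := 1) isT).
  move=> e e0; have [d d0 Hd] := inB_uniform_continuous uB (in_time_lt tT) e0.
  by exists d => // s sT st x; exact: (Hd s (in_time_lt sT) st 1%N x).
apply: uniform_continuous_strip => t tT.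
  rewrite (_ : (fun x => pdt u x t) = V t); last by apply/funext => x; exact: utE.
  exact: is_derive_continuous (dV t (in_time_lt tT) 0 isT).
move=> e e0; have [d d0 Hd] := Vc t e (in_time_lt tT) e0.
exists d => // s sT st x; rewrite !utE //; exact: (Hd s (in_time_lt sT) st 0%N x).
Qed.

(* With [w] the left-hand side of the non-local equation, [w - w''] is the
   defect of the local one, and a bounded [w] with [w'' = w] vanishes. *)
Lemma DP_local_nonlocal : DP_local T u <-> DP_nonlocal T u.
Proof.
have [V [dV Vb Vc dt]] := inB_time_derivative uB.
(* Both equations at time [t] involve [u_t] and [u_txx] merely as functions of [x], so time can be
   frozen. *)
suff key (t : R) : 0 < t < T ->
    (forall x, pdt u x t - pdt (pdx (pdx u)) x t + 4 * u x t * pdx u x t =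
      3 * pdx u x t * pdx (pdx u) x t + u x t * pdx (pdx (pdx u)) x t) <->
    (forall x, pdt u x t + u x t * pdx u x t +
      (3 / 2) * dxLambdam2 (fun y => u y t ^+ 2) x = 0).
  by split=> H x t tT; move: x; apply/(key t tT) => x; exact: H.
move=> tT; have tI := in_time_lt tT.
have utE x : pdt u x t = V t x.
  by rewrite /pdt derive1E; have h := dt t tT 0%N x isT; apply: derive_val.
have uxxtE x : pdt (pdx (pdx u)) x t = iterD 2 (V t) x.
  by rewrite /pdt derive1E; have h := dt t tT 2%N x isT; apply: derive_val.
pose f j := iterD j (fun y => u y t).
have df j : (j < 3)%N -> forall x : R, is_derive x 1 (f j) (f j.+1 x) := inB_is_derive uB tI (j := j).
have dv j : (j < 2)%N -> forall x : R, is_derive x 1 (iterD j (V t)) (iterD j.+1 (V t) x) := dV t tI j.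
pose g x := f 0%N x ^+ 2.
have f0 x := df 0%N isT x; have f1 x := df 1%N isT x; have f2 x := df 2%N isT x.
have v0 x := dv 0%N isT x; have v1 x := dv 1%N isT x.
have dg (x : R) : is_derive x 1 g (2 * f 0%N x * f 1%N x).
  by apply: is_derive_eq; rewrite /GRing.scale /=; ring.
have ig := L2_integrable_sq (inB_L2 uB tI).
have cg := is_derive_continuous dg.
have [p dp] := dxLambdam2_is_derive cg ig.
have [Mh hM] := dxLambdam2_bounded cg ig.
set h := dxLambdam2 g in dp hM.
pose w x := V t x + f 0%N x * f 1%N x + (3 / 2) * h x.
pose w1 x := iterD 1 (V t) x + (f 1%N x * f 1%N x + f 0%N x * f 2%N x) + (3 / 2) * (p x - g x).
pose w2 x := iterD 2 (V t) x + (3 * (f 1%N x * f 2%N x) + f 0%N x * f 3%N x) +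
  (3 / 2) * (h x - 2 * f 0%N x * f 1%N x).
have dw (x : R) : is_derive x 1 w (w1 x).
  exact: is_derive_nonlocal (f0 x) (f1 x) (v0 x) (dp x).1.
have dw1 (x : R) : is_derive x 1 w1 (w2 x).
  exact: is_derive2_nonlocal (f0 x) (f1 x) (f2 x) (v1 x) (dp x).2.
have defect x : w x - w2 x = V t x - iterD 2 (V t) x + 4 * f 0%N x * f 1%N x -
    (3 * f 1%N x * f 2%N x + f 0%N x * f 3%N x).
  exact: nonlocal_defect.
split=> H x; last first.
  have w0 : w = fun=> 0.
    by apply/funext => y; rewrite -(H y) utE.
  have w10 : w1 = fun=> 0.
    rewrite -(derive1_ext dw) w0; apply: derive1_ext => y; exact: is_derive_cst.
  have w20 : w2 = fun=> 0.
    rewrite -(derive1_ext dw1) w10; apply: derive1_ext => y; exact: is_derive_cst.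
  have := defect x; rewrite w0 w20 subrr utE uxxtE => E.
  by apply/eqP; rewrite -subr_eq0 [X in _ == X]E.
have ww2 y : w2 y = w y.
  apply/eqP; rewrite eq_sym -subr_eq0 defect; have := H y; rewrite utE uxxtE => E.
  by rewrite subr_eq0; apply/eqP.
have [Mu uM] := inB_bounded uB tI.
have [Mv vM] := Vb t tI.
have wM y : `|w y| <= Mv + Mu * Mu + 3 / 2 * Mh.
  apply: le_trans (ler_normD _ _) _; apply: lerD; last first.
    by rewrite normrM ger0_norm ?ler_wpM2l //; lra.
  apply: le_trans (ler_normD _ _) _; apply: lerD; first exact: (vM 0%N).
  by rewrite normrM; apply: ler_pM => //; apply: uM.
have dw1' (y : R) : is_derive y 1 w1 (w y) by rewrite -ww2.
have := bounded_second_order_eq0 dw dw1' wM x.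
by rewrite utE.
Qed.

Lemma jc_jet (x t : R) k : (k < 5)%N ->
  jc (jet u x t) k = nth 0 [:: x; t; u x t; pdx u x t; pdx (pdx u) x t] k.
Proof. by move=> k5; rewrite /jc mxE inordK. Qed.

(** Each form is [(k m + c) dx + k F dt] with constants [k], [c]. In a wedge of two of them the
    products [m F] cancel and [(c_a k_b - k_a c_b) F] remains; the constants are tuned so that this
    is [-2 F] times the [k] of the third form. *)
Lemma DP_local_structure_eqs mu b : DP_local T u <-> structure_eqs T (DP_forms mu b) u.
Proof.
have [V [dV Vb Vc dt]] := inB_time_derivative uB.
set s : R := if b then 1 else -1.
have s2 : s * s = 1 by rewrite /s; case: ifP => _; rewrite ?mulrNN mulr1.
set r := Num.sqrt (1 + mu ^+ 2).
have r2 : r * r = 1 + mu * mu.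
  by rewrite -expr2 sqr_sqrtr // addr_ge0 ?sqr_ge0.
pose m x t := u x t - pdx (pdx u) x t.
pose F x t := pdx u x t ^+ 2 - 2 * u x t * pdx u x t + u x t * pdx (pdx u) x t.
have jmE x t : jm (jet u x t) = m x t by rewrite /jm !jc_jet.
have jFE x t : jF (jet u x t) = F x t by rewrite /jF !jc_jet.
pose Fx x t := 3 * pdx u x t * pdx (pdx u) x t + u x t * pdx (pdx (pdx u)) x t
  - 2 * pdx u x t ^+ 2 - 2 * u x t * pdx (pdx u) x t.
pose mt x t := pdt u x t - pdt (pdx (pdx u)) x t.
have dm (x t : R) : 0 < t < T -> is_derive t 1 (fun s : R => m x s) (mt x t).
  move=> tT.
  have d0 : is_derive t 1 (fun s : R => u x s) (V t x) := dt t tT 0%N x isT.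
  have d2 : is_derive t 1 (fun s : R => pdx (pdx u) x s) (iterD 2 (V t) x) := dt t tT 2%N x isT.
  rewrite /mt /pdt !derive1E !derive_val; exact: is_deriveB.
have dF (x t : R) : 0 < t < T -> is_derive x 1 (fun y : R => F y t) (Fx x t).
  move=> tT; have tI := in_time_lt tT.
  have d0 : is_derive x 1 (fun y : R => u y t) (pdx u x t) := inB_is_derive uB tI (j := 0) isT x.
  have d1 : is_derive x 1 (fun y : R => pdx u y t) (pdx (pdx u) x t) := inB_is_derive uB tI (j := 1) isT x.
  have d2 : is_derive x 1 (fun y : R => pdx (pdx u) y t) (pdx (pdx (pdx u)) x t) := inB_is_derive uB tI (j := 2) isT x.
  exact: is_derive_flux d0 d1 d2.
(* The defaults of [nth] carry the constants of the third form, matching the catch-all branch of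
   [DP_forms]. *)
have c0 (i : nat) x t : coef (DP_forms mu b) u i 0 x t =
    nth (s * r) [:: 1; mu] i * m x t + nth (2 * mu) [:: 0; s * 2 * r] i.
  by case: i => [|[|i]]; rewrite /coef /DP_forms jmE /= ?nth_nil ?mul1r ?addr0.
have c1 (i : nat) x t : coef (DP_forms mu b) u i 1 x t = nth (s * r) [:: 1; mu] i * F x t.
  by case: i => [|[|i]]; rewrite /coef /DP_forms jFE /= ?nth_nil ?mul1r.
have d0 (i : nat) (x t : R) : 0 < t < T ->
    is_derive t 1 (fun s => coef (DP_forms mu b) u i 0 x s) (nth (s * r) [:: 1; mu] i * mt x t).
  move=> tT; under eq_fun do rewrite c0.
  have h := dm x t tT.
  by apply: is_derive_eq; rewrite /GRing.scale /=; ring.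
have d1 (i : nat) (x t : R) : 0 < t < T ->
    is_derive x 1 (fun y => coef (DP_forms mu b) u i 1 y t) (nth (s * r) [:: 1; mu] i * Fx x t).
  move=> tT; under eq_fun do rewrite c1.
  have h := dF x t tT.
  by apply: is_derive_eq; rewrite /GRing.scale /=; ring.
have dformE i x t : 0 < t < T -> dform (DP_forms mu b) u i x t = nth (s * r) [:: 1; mu] i * (Fx x t - mt x t).
  move=> tT; have h0 := d0 i x t tT; have h1 := d1 i x t tT.
  by rewrite /dform mulrBr; congr (_ - _); apply: etrans (derive1E _ _) _; apply: derive_val.
have defect x t : Fx x t - mt x t + 2 * F x t =
    3 * pdx u x t * pdx (pdx u) x t + u x t * pdx (pdx (pdx u)) x t -
    (pdt u x t - pdt (pdx (pdx u)) x t + 4 * u x t * pdx u x t).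
  exact: flux_defect.
have w21 x t : wedge (DP_forms mu b) u 2 1 x t = - (2 * F x t).
  rewrite /wedge !c0 !c1 /=.
  (* Here the radical earns its place: [2 mu^2 - 2 s^2 r^2 = -2] for either sign. *)
  have -> : (s * r * m x t + 2 * mu) * (mu * F x t) - s * r * F x t * (mu * m x t + s * 2 * r) =
    2 * (mu * mu) * F x t - 2 * (s * s) * (r * r) * F x t by ring.
  by rewrite s2 r2; ring.
have w02 x t : wedge (DP_forms mu b) u 0 2 x t = - (mu * (2 * F x t)).
  by rewrite /wedge !c0 !c1 /=; ring.
have w01 x t : wedge (DP_forms mu b) u 0 1 x t = - (s * r * (2 * F x t)).
  by rewrite /wedge !c0 !c1 /=; ring.
split=> H x t tT.
  have E : Fx x t - mt x t = - (2 * F x t).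
    by apply/eqP; rewrite -subr_eq0 opprK defect H // subrr.
  split; first by move=> i _; have h0 := d0 i x t tT; have h1 := d1 i x t tT; split; [case: h1|case: h0].
  by rewrite !dformE // w21 w02 w01 E /= mul1r !mulrN.
have [_ [+ _]] := H x t tT; rewrite dformE // w21 /= mul1r => E.
by have := defect x t; rewrite E addNr => /esym/eqP; rewrite subr_eq0 => /eqP.
Qed.

End DegasperisProcesi.

(** * The coefficients as functions on jet space *)

Section JetForms.
Variable R : realType.
Implicit Types g : 'rV[R]_5 -> R.

Lemma C1_jet_cst (c : R) : C1_jet (fun=> c).
Proof.
split; first by move=> p; exact: (@cst_continuous _ _ c p).
move=> i; split; first by move=> p; exact: derivable_cst.
have -> : 'D_(delta_mx ord0 i) (fun _ : 'rV[R]_5 => c) = fun=> 0 by apply/funext => p; exact: derive_cst.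
by move=> p; exact: (@cst_continuous _ _ 0 p).
Qed.

Lemma is_derive_jc (p v : 'rV[R]_5) k : is_derive p v (fun q => jc q k) (jc v k).
Proof.
have cv : (fun h : R => h^-1 *: (((fun q => jc q k) \o shift p) (h *: v) - jc p k)) @ 0^' --> jc v k.
  apply/cvgrPdist_le => e e0; near=> h.
  have h0 : h != 0 by near: h; exact: nbhs_dnbhs_neq.
  rewrite /jc /= !mxE addrK /GRing.scale /= mulrA mulVf // mul1r subrr normr0 ltW //.
apply: DeriveDef; first by apply/cvg_ex; exists (jc v k).
exact/cvg_lim.
Unshelve. all: by end_near. Qed.

Lemma C1_jet_jc k : C1_jet (fun p : 'rV[R]_5 => jc p k).
Proof.
split; first by move=> p; exact: coord_continuous.
move=> i; split; first by move=> p; case: (is_derive_jc p (delta_mx ord0 i) k).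
have -> : 'D_(delta_mx ord0 i) (fun p : 'rV[R]_5 => jc p k) = fun=> jc (delta_mx ord0 i) k.
  by apply/funext => p; have h := is_derive_jc p (delta_mx ord0 i) k; apply: derive_val.
by move=> p; exact: (@cst_continuous _ _ _ p).
Qed.

Lemma C1_jetD g1 g2 : C1_jet g1 -> C1_jet g2 -> C1_jet (fun p => g1 p + g2 p).
Proof.
move=> [c1 d1] [c2 d2]; split; first by move=> p; exact: (cvgD (c1 p) (c2 p)).
move=> i; have [e1 f1] := d1 i; have [e2 f2] := d2 i.
split; first by move=> p; apply: derivableD.
have -> : 'D_(delta_mx ord0 i) (fun p => g1 p + g2 p) =
    (fun p => 'D_(delta_mx ord0 i) g1 p + 'D_(delta_mx ord0 i) g2 p).
  by apply/funext => p; exact: deriveD.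
by move=> p; exact: (cvgD (f1 p) (f2 p)).
Qed.

Lemma C1_jetM g1 g2 : C1_jet g1 -> C1_jet g2 -> C1_jet (fun p => g1 p * g2 p).
Proof.
move=> [c1 d1] [c2 d2]; split; first by move=> p; exact: (cvgM (c1 p) (c2 p)).
move=> i; have [e1 f1] := d1 i; have [e2 f2] := d2 i.
split; first by move=> p; apply: derivableM.
have -> : 'D_(delta_mx ord0 i) (fun p => g1 p * g2 p) =
    (fun p => g1 p * 'D_(delta_mx ord0 i) g2 p + g2 p * 'D_(delta_mx ord0 i) g1 p).
  by apply/funext => p; exact: deriveM.
by move=> p; exact: (cvgD (cvgM (c1 p) (f2 p)) (cvgM (c2 p) (f1 p))).
Qed.

Lemma C1_jet_DP_forms (mu : R) b i j : C1_jet (DP_forms mu b i j).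
Proof.
have cM (c : R) g : C1_jet g -> C1_jet (fun p => c * g p).
  by move=> cg; exact: C1_jetM (C1_jet_cst c) cg.
have cm : C1_jet (@jm R).
  rewrite (_ : @jm R = fun p => jc p 2 + -1 * jc p 4); last by apply/funext => p; rewrite mulN1r.
  exact: C1_jetD (C1_jet_jc 2) (cM _ _ (C1_jet_jc 4)).
have cF : C1_jet (@jF R).
  rewrite (_ : @jF R = fun p => jc p 3 * jc p 3 + (-2 * (jc p 2 * jc p 3) + jc p 2 * jc p 4)); last first.
    by apply/funext => p; rewrite /jF; ring.
  have J := C1_jet_jc; apply: C1_jetD (C1_jetM (J 3) (J 3)) (C1_jetD (cM _ _ (C1_jetM (J 2) (J 3))) (C1_jetM (J 2) (J 4))).
case: i => [|[|i]]; case: j => [|j].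
- exact: cm.
- exact: cF.
- exact: C1_jetD (cM _ _ cm) (C1_jet_cst _).
- exact: cM.
- exact: C1_jetD (cM _ _ cm) (C1_jet_cst _).
- exact: cM.
Qed.

Lemma DP_forms_nondegenerate (mu : R) b : exists p,
  DP_forms mu b 0 0 p * DP_forms mu b 1 1 p - DP_forms mu b 0 1 p * DP_forms mu b 1 0 p != 0.
Proof.
(* The jet with [u_x = 1] and all other entries 0 has [m = 0] and [F = 1], where the wedge is
   [-2 s r]. *)
exists (\row_(i < 5) (i == inord 3)%:R).
set p := \row_ _ _.
have pE k : (k < 5)%N -> jc p k = (k == 3)%:R.
  by move=> k5; rewrite /jc mxE -val_eqE /= !inordK.
rewrite /DP_forms /jm /jF !pE //=.
set r := Num.sqrt _; set s : R := if b then _ else _.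
have r0 : r != 0 by rewrite gt_eqF // sqrtr_gt0 ltr_pwDl // sqr_ge0.
have s0 : s != 0 by rewrite /s; case: ifP => _; rewrite ?oppr_eq0 oner_eq0.
rewrite (_ : _ - _ = - (2 * s * r)); last by ring.
by rewrite oppr_eq0 !mulf_neq0 // pnatr_eq0.
Qed.

End JetForms.

Theorem theorem2p1 (R : realType) (T mu : R) (b : bool) (hT : 0 < T) :
  PSS_C1 T (inB T) (DP_local T) (DP_forms mu b) /\
  PSS_C1 T (inB T) (DP_nonlocal T) (DP_forms mu b) /\
  (forall u : R -> R -> R, inB T u -> (DP_local T u <-> DP_nonlocal T u)).
Proof.
split; [|split]; last exact: DP_local_nonlocal.
  split; first exact: inB_C1_strip.
  split; first by move=> i j _ _; exact: C1_jet_DP_forms.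
  split; first exact: DP_forms_nondegenerate.
  by move=> u uB; exact: DP_local_structure_eqs.
split; first exact: inB_C1_strip.
split; first by move=> i j _ _; exact: C1_jet_DP_forms.
split; first exact: DP_forms_nondegenerate.
move=> u uB; rewrite -DP_local_nonlocal //; exact: DP_local_structure_eqs.
Qed.
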